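(* Let $\lambda_n\to0$ and $n\lambda_n^3\to\infty$, let $d>-1$ be fixed and $d^*=\max(1,d)$. Suppose that the sequence of alternatives belongs to the intermediate family $\mathfrak{I}_{alt}$ and that one of the following holds: (i) $d\in(-1,0]$ or $d\ge1$ is an integer, and $\varepsilon(N)\ll\left(n^{d^*}\lambda_n^{d^*-1}\right)^{-1/(2d^*+1)}$; (ii) $d>0$ is not an integer and $\varepsilon(N)\ll\min\left(\left(n\lambda_n^{4/3}\right)^{-3/8},\ \left(n^{d^*}\lambda_n^{d^*-1}\right)^{-1/(2d^*+1)}\right)$. Then, as $n\to\infty$, $$\frac{e_N^{\alpha}(S_N^{h_d})}{n\lambda_n\,\varepsilon^2(N)}=\frac14\,\rho^2(h_d,\lambda_n)\,(1+o(1)).$$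
   Context: All asymptotics are as $n\to\infty$; $a_n\ll b_n$ means $a_n=o(b_n)$. $N=N(n)\to\infty$, $\lambda_n=n/N$ converges to a limit in $[0,\infty]$, and $n^2/N=n\lambda_n\to\infty$. The random vector $(\eta_1,\dots,\eta_N)$ has the multinomial distribution with $n$ trials and cell probabilities $(p_1,\dots,p_N)$, $p_m>0$, $\sum_m p_m=1$. The hypothesis is $H_0: p_m=1/N$ for all $m$; $P_0$ denotes probability under $H_0$. Alternatives $H_{1n}$ are sequences $p_m=N^{-1}(1+\varepsilon_{m,n})\ (m=1,\dots,N)$, not identically uniform, with $\sum_m\varepsilon_{m,n}=0$, $\max_{m}|\varepsilon_{m,n}|\to0$; put $\varepsilon(N)=\frac1N\sum_{m=1}^N(Np_m-1)^2$, so $\varepsilon(N)\to0$. The intermediate family $\mathfrak{I}_{alt}$ consists of all such sequences of alternatives with $\sqrt{n\lambda_n}\,\varepsilon(N)\to\infty$ and $\varepsilon(N)=o(\lambda_n^{-1})$. For a function $h$ on $\{0,1,2,\dots\}$ (possibly depending on $\lambda_n$) let $S_N^h=\sum_{m=1}^N h(\eta_m)$ (large values reject $H_0$), let $A_1(h)=N^{-1}\sum_{m=1}^N E\,h(\xi_m)$ where $\xi_m$ is Poisson with parameter $np_m$, the $p_m$ being the cell probabilities under $H_{1n}$, and define $$e_N^{\alpha}(S_N^h)=-\log P_0\{S_N^h>N A_1(h)\}.$$ Power divergence functions: for $d>-1$, $d\ne0$, $h_d(x)=\frac{2}{d(d+1)}\,x\left[(x/\lambda_n)^d-1\right]$, and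 $h_0(x)=2x\log(x/\lambda_n)$, with $h_d(0)=0$. With $\xi$ Poisson with parameter $\lambda_n$ and $\tau_n=\lambda_n^{-1}\operatorname{cov}(h(\xi),\xi)$, put $\rho(h,\lambda_n)=\operatorname{corr}\left(h(\xi)-\tau_n\xi,\ \xi^2-(2\lambda_n+1)\xi\right)$. *)

(* Defs.v *)
From HB Require Import structures.
From mathcomp Require Import all_boot all_order all_algebra.
From mathcomp Require Import all_classical all_reals all_analysis.

Set Implicit Arguments.
Unset Strict Implicit.
Unset Printing Implicit Defensive.

Import Order.TTheory GRing.Theory Num.Theory.
Import numFieldNormedType.Exports.

Local Open Scope classical_set_scope.
Local Open Scope ring_scope.

Section Multinomial.
Context {R : realType}.
Variables (n N : nat) (p : 'I_N -> R).

Definition multinomial_pmf (k : {ffun 'I_N -> 'I_n.+1}) : R :=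
  if (\sum_m k m == n)%N
  then n`!%:R / (\prod_m (k m)`!)%:R * \prod_m p m ^+ k m
  else 0.

(* Each count is at most n, so the vectors with entries in 'I_n.+1 carry the
   whole multinomial law. *)
Definition multinomial_prob (A : pred ('I_N -> nat)) : R :=
  \sum_(k : {ffun 'I_N -> 'I_n.+1} | A (fun m => k m : nat))
     multinomial_pmf k.

End Multinomial.

Section Poisson.
Context {R : realType}.
Variable mu : R.

(* The nat argument 0 of poisson_prob is a dummy: its body ignores it. *)
Let P := poisson_prob mu 0.

Definition poisson_E (f : nat -> R) : R := fine 'E_P[f].

Definition poisson_cov (f g : nat -> R) : R :=
  fine (covariance P f g).

Definition poisson_corr (f g : nat -> R) : R :=
  poisson_cov f g / Num.sqrt (poisson_cov f f * poisson_cov g g).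

Definition tau (h : nat -> R) : R :=
  mu^-1 * poisson_cov h (fun x => x%:R).

Definition rho (h : nat -> R) : R :=
  poisson_corr (fun x => h x - tau h * x%:R)
               (fun x => x%:R ^+ 2 - (2 * mu + 1) * x%:R).

End Poisson.

(* The factor x%:R makes the value at x = 0 equal to 0 in both branches, also
   for d < 0 and for the logarithm, since powR and ln are total. *)
Definition power_div {R : realType} (d lam : R) (x : nat) : R :=
  if d == 0 then 2 * x%:R * ln (x%:R / lam)
  else 2 / (d * (d + 1)) * x%:R * ((x%:R / lam) `^ d - 1).

Section Scheme.
Context {R : realType}.
Variable N : nat -> nat.

Definition lam (n : nat) : R := n%:R / (N n)%:R.

Definition multinomial_scheme : Prop :=
  [/\ N @ \oo --> \oo,
      exists l : \bar R, (0 <= l)%E /\ (fun n => (lam n)%:E) @ \oo --> l &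
      (fun n => n%:R ^+ 2 / (N n)%:R : R) @ \oo --> +oo].

Variable eps : forall n, 'I_(N n) -> R.

Definition cell_prob (n : nat) (m : 'I_(N n)) : R :=
  (N n)%:R^-1 * (1 + eps m).

Definition eps_bar (n : nat) : R :=
  (N n)%:R^-1 * \sum_(m < N n) ((N n)%:R * cell_prob m - 1) ^+ 2.

Record alternatives : Prop := Alternatives {
  alt_pos : forall n, (0 < n)%N -> forall m : 'I_(N n), 0 < cell_prob m;
  alt_sum0 : forall n, (0 < n)%N -> \sum_(m < N n) eps m = 0;
  alt_neq_unif : forall n, (0 < n)%N ->
    exists m : 'I_(N n), cell_prob m != (N n)%:R^-1;
  alt_max_to0 :
    (fun n => \big[Num.max/0]_(m < N n) `|eps m|) @ \oo --> (0 : R) }.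

Definition intermediate_alternatives : Prop :=
  [/\ alternatives,
      (fun n => Num.sqrt (n%:R * lam n) * eps_bar n) @ \oo --> +oo &
      eps_bar =o_\oo (fun n => (lam n)^-1)].

Definition stat (h : nat -> R) (n : nat) (eta : 'I_(N n) -> nat) : R :=
  \sum_(m < N n) h (eta m).

Definition A1 (h : nat -> R) (n : nat) : R :=
  (N n)%:R^-1 * \sum_(m < N n) poisson_E (n%:R * cell_prob m) h.

Definition prob_H0 (n : nat) (A : pred ('I_(N n) -> nat)) : R :=
  multinomial_prob n (fun _ => (N n)%:R^-1) A.

(* ln is total with ln 0 = 0, so a null event gives 0 here instead of +oo.  An
   asymptotic equality with a positive right-hand side excludes null events
   for large n either way. *)
Definition alpha_slope (h : nat -> R) (n : nat) : R :=
  - ln (@prob_H0 n (fun eta => (N n)%:R * A1 h n < stat h eta)).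

End Scheme.

(* Main.v *)
Require Import Defs.
From HB Require Import structures.
From mathcomp Require Import all_boot all_order all_algebra.
From mathcomp Require Import all_classical all_reals all_analysis.
From mathcomp Require Import ring lra zify.
Set Implicit Arguments.
Unset Strict Implicit.
Unset Printing Implicit Defensive.
Import Order.TTheory GRing.Theory Num.Theory.
Import numFieldNormedType.Exports.
Local Open Scope classical_set_scope.
Local Open Scope ring_scope.

(** The power divergence statistic of a count vector of total n is an affine
    image of that of a fixed kernel f, namely h_d at lam = 1: writing
    h_d(k) = lam^(-d) f(k) + beta k, the linear part is constant on vectors of
    total n and equally so in the threshold N A_1, the Poisson means adding up
    to n.  So S > N A_1 is the event that the sum of the f(eta_m) exceeds T,
    the sum of the means E f(xi_m).  This kernel vanishes at 0 and 1, is
    positive at 2 and nondecreasing.  When lam -> 0 the sum is, up to lower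
    order, f(2) times the number of cells holding exactly two balls, which is
    close to Poisson with mean n lam / 2.  The alternatives raise the mean by
    the fraction e = eps(N): up to a term linear in eps_m, which cancels in the
    sum, E f(xi_m) moves by f(2) lam^2 eps_m^2 / 2.  An increase of a Poisson
    variable of large mean M by a small fraction e costs exp (- M e^2 / 2), here
    exp (- n lam e^2 / 4).  For the same reason rho tends to 1 in absolute
    value: modulo affine functions, f and the quadratic polynomial of its
    definition are both proportional to the indicator of 2 in the limit.  The
    theorem thus splits into [rho_sqr_near1] and [slope_near_quarter].

    The exponent must be found up to o(n lam e^2), a quantity that may tend to
    infinity as slowly as one likes, so that even the factor of order sqrt n
    lost when independent Poisson counts are conditioned on their total is too
    much.  Monotonicity avoids this loss.  As f is nondecreasing, the
    probability of the event increases with the number of balls, while the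
    independent Poisson model is a mixture over that number.  Restricting the
    mixture to at least n balls bounds the multinomial probability from above
    at the cost of a constant factor ([mixture_upper] with
    [poisson_upper_half]); restricting it to at most n balls bounds it from
    below ([mixture_lower]) once the intensity is lowered by a fraction small
    compared with e.

    For independent counts the upper bound is a Chernoff bound with parameter
    e / f(2) ([upper_bound]).  It needs f truncated at a level K such that
    e f(k) <= f(2) k for k <= K, while a cell with more than K balls must be
    less likely than exp (- n lam e^2).  The rate assumed for e, together with
    n lam^3 -> oo, is what makes room for such a K
    ([exists_truncation_level]).  The lower bound ([lower_bound]) tilts the
    probability of a pair by a factor slightly above exp e and applies
    Chebyshev's inequality under the tilted law. *)

(** * Poisson expectations as series *)

(** Growth at most geometric makes every Poisson expectation an absolutely
    convergent series and is stable under products.  The exponent k + 1 lets the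
    base absorb a multiplicative constant. *)
Definition geom_bounded {R : realType} (a : R) (F : nat -> R) :=
  forall k, `|F k| <= a ^+ k.+1.

Section PoissonSeries.
Context {R : realType}.
Implicit Types (mu a : R) (F G : nat -> R).

Lemma poisson_pmfE mu k : 0 < mu ->
  poisson_pmf mu k = mu ^+ k / k`!%:R * expR (- mu).
Proof. by move=> mu0; rewrite /poisson_pmf mu0. Qed.

Lemma poisson_pmf_gt0 mu k : 0 < mu -> 0 < poisson_pmf mu k.
Proof.
by move=> mu0; rewrite poisson_pmfE// !mulr_gt0 ?expR_gt0 ?exprn_gt0//.
Qed.

Lemma geom_pmf_bound mu a F k : 0 < mu -> geom_bounded a F ->
  `|poisson_pmf mu k * F k| <= a * expR (- mu) * exp_coeff (a * mu) k.
Proof.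
move=> mu0 aF; rewrite normrM ger0_norm ?poisson_pmf_ge0//.
apply: le_trans (ler_wpM2l (poisson_pmf_ge0 mu k) (aF k)) _.
rewrite poisson_pmfE// /exp_coeff/= exprMn exprS.
by rewrite le_eqVlt; apply/orP; left; apply/eqP; ring.
Qed.

Lemma is_cvg_geom mu a F : 0 < mu -> geom_bounded a F ->
  cvgn (series (fun k => poisson_pmf mu k * F k)).
Proof.
move=> mu0 aF; apply: normed_cvg.
apply: (@series_le_cvg _ _ (fun k => a * expR (- mu) * exp_coeff (a * mu) k)) => //.
- by move=> k /=; exact: normr_ge0.
- by move=> k /=; apply: le_trans (geom_pmf_bound k mu0 aF).
- by move=> k; exact: geom_pmf_bound.
- rewrite (_ : (fun k => _) = (a * expR (- mu)) *: exp_coeff (a * mu)).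
    exact/is_cvg_seriesZ/is_cvg_series_exp_coeff.
  by apply/funext => k.
Qed.

Let weighted_dirac mu (mu0 : 0 < mu) (k : nat) : {measure set nat -> \bar R} :=
  mscale (NngNum (poisson_pmf_ge0 mu k)) (@dirac _ nat k R).

(** The Poisson law is a countable sum of scaled Dirac masses. *)
Lemma poisson_nn_series mu F : 0 < mu -> (forall k, 0 <= F k) ->
  cvgn (series (fun k => poisson_pmf mu k * F k)) ->
  ('E_(poisson_prob mu 0)[F] = (limn (series (fun k => poisson_pmf mu k * F k)))%:E)%E.
Proof.
move=> mu0 F0 cF; rewrite unlock.
rewrite (@eq_measure_integral _ _ _ setT (mseries (weighted_dirac mu0) 0)); last first.
  move=> A _ _; rewrite /= /poisson_prob mu0 /mseries /=.
  rewrite -[RHS]/(\sum_(0 <= k <oo) (poisson_pmf mu k)%:E * \d_k A)%E.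
  rewrite nneseries_esumT; last first.
    by move=> k; rewrite mule_ge0 ?lee_fin ?poisson_pmf_ge0// diracE lee_fin.
  rewrite [LHS]esum_mkcond; apply: eq_esum => k _; rewrite diracE.
  by case: ifPn => _; rewrite ?mule1 ?mule0.
rewrite ge0_integral_measure_series//; last first.
  by move=> k _; rewrite lee_fin.
rewrite -EFin_lim//; apply: congr_lim; apply/funext => n /=.
rewrite -sumEFin; apply: eq_bigr => k _.
rewrite ge0_integral_mscale//; last by move=> ? _; rewrite lee_fin.
by rewrite integral_dirac// diracT mul1e.
Qed.


Lemma geom_ge0 a F : geom_bounded a F -> 0 <= a.
Proof. by move=> /(_ 0%N); rewrite expr1; exact: le_trans. Qed.

Lemma poisson_Lfun mu a F : 0 < mu -> geom_bounded a F ->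
  F \in Lfun (poisson_prob mu 0) 1.
Proof.
move=> mu0 aF; apply/Lfun1_integrable/integrableP; split => //.
rewrite -[X in (X < _)%E]/(\int[_]_x (`|F x|)%:E)%E.
have aF' : geom_bounded a (fun k => `|F k|) by move=> k; rewrite normr_id.
have := poisson_nn_series mu0 (fun k => normr_ge0 (F k)) (is_cvg_geom mu0 aF').
by rewrite unlock => ->; rewrite ltry.
Qed.

(** Adding and subtracting the dominating geometric function reduces a signed
    function to nonnegative ones. *)
Lemma poisson_E_cvg mu a F : 0 < mu -> geom_bounded a F ->
  series (fun k => poisson_pmf mu k * F k) @ \oo --> poisson_E mu F.
Proof.
move=> mu0 aF; have a0 := geom_ge0 aF.
pose G k := a ^+ k.+1.
have G0 k : 0 <= G k by rewrite exprn_ge0.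
have gG : geom_bounded a G by move=> k; rewrite ger0_norm.
have FG0 k : 0 <= F k + G k.
  by rewrite -lerBlDr sub0r; have := aF k; rewrite ler_norml => /andP[].
have gFG : geom_bounded (a + a) (fun k => F k + G k).
  move=> k; apply: le_trans (ler_normD _ _) _.
  apply: le_trans (lerD (aF k) (gG k)) _.
  rewrite -mulr2n -mulr_natr -mulr2n -(mulr_natr a) exprMn ler_wpM2l ?exprn_ge0//.
  by rewrite exprS ler_peMr// exprn_ege1// ler1n.
have eF : F = (fun k => F k + G k) \- G by apply/funext => k /=; rewrite addrK.
have E1 := poisson_nn_series mu0 FG0 (is_cvg_geom mu0 gFG).
have E2 := poisson_nn_series mu0 G0 (is_cvg_geom mu0 gG).
have -> : poisson_E mu F = limn (series (fun k => poisson_pmf mu k * (F k + G k)))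
                       - limn (series (fun k => poisson_pmf mu k * G k)).
  rewrite /poisson_E [in LHS]eF expectationB; last 2 first.
    exact: (poisson_Lfun mu0 gFG).
    exact: (poisson_Lfun mu0 gG).
  by rewrite [X in fine (X - _)]E1 E2.
rewrite [X in X @ _](_ : _ = series (fun k => poisson_pmf mu k * (F k + G k))
                       - series (fun k => poisson_pmf mu k * G k)); last first.
  apply/funext => n; rewrite /series/= fctE -sumrB.
  by apply: eq_bigr => k _; rewrite mulrDr addrK.
by apply: cvgB; [exact: is_cvg_geom mu0 gFG|exact: is_cvg_geom mu0 gG].
Qed.

Definition tame F := exists2 a, 1 <= a & geom_bounded a F.

Lemma tame_le F G : tame G -> (forall k, `|F k| <= `|G k|) -> tame F.
Proof. by move=> [a a1 aG] FG; exists a => // k; apply: le_trans (FG k) _. Qed.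

Lemma tame_cst (c : R) : tame (fun=> c).
Proof.
exists (1 + `|c|); first by rewrite lerDl.
move=> k; rewrite exprS; apply: (@le_trans _ _ ((1 + `|c|) * 1)).
  by rewrite mulr1 lerDr.
by rewrite ler_wpM2l ?addr_ge0// exprn_ege1// lerDl.
Qed.

Lemma tame_mul F G : tame F -> tame G -> tame (fun k => F k * G k).
Proof.
move=> [a a1 aF] [b b1 bG]; exists (a * b); first by rewrite mulr_ege1.
by move=> k; rewrite normrM exprMn ler_pM.
Qed.

Lemma tame_add F G : tame F -> tame G -> tame (fun k => F k + G k).
Proof.
move=> [a a1 aF] [b b1 bG]; exists (a + b).
  by rewrite (le_trans a1)// lerDl (le_trans _ b1).
have a0 : 0 <= a by exact: le_trans a1.
have b0 : 0 <= b by exact: le_trans b1.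
move=> k; apply: le_trans (ler_normD _ _) _.
apply: le_trans (lerD (aF k) (bG k)) _.
elim: k => [|k IH]; first by rewrite !expr1.
rewrite exprS (exprS b) (exprS (a + b)) mulrDl.
apply: lerD; rewrite ler_wpM2l//; apply: le_trans IH.
  by rewrite lerDl exprn_ge0.
by rewrite lerDr exprn_ge0.
Qed.

Lemma tame_scale c F : tame F -> tame (fun k => c * F k).
Proof. by move=> tF; apply: tame_mul => //; exact: tame_cst. Qed.

Lemma tame_id : tame (fun k => k%:R).
Proof.
exists 2; first by rewrite ler1n.
move=> k; rewrite normr_nat -natrX ler_nat.
by apply: leq_trans (ltnW (ltn_expl k (ltnSn 1))) _; rewrite leq_exp2l.
Qed.

Lemma tame_exp (b : R) : tame (fun k => b ^+ k).
Proof.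
exists (1 + `|b|); first by rewrite lerDl.
move=> k; rewrite normrX exprS.
apply: (@le_trans _ _ (1 * (1 + `|b|) ^+ k)).
  by rewrite mul1r lerXn2r ?nnegrE ?addr_ge0// lerDr.
by rewrite ler_wpM2r ?exprn_ge0 ?addr_ge0// lerDl.
Qed.

Lemma poisson_E_lim mu F : 0 < mu -> tame F ->
  series (fun k => poisson_pmf mu k * F k) @ \oo --> poisson_E mu F.
Proof. by move=> mu0 [a _ aF]; exact: poisson_E_cvg mu0 aF. Qed.

Lemma poisson_E_lin mu (b c : R) F G : 0 < mu -> tame F -> tame G ->
  poisson_E mu (fun k => b * F k + c * G k) = b * poisson_E mu F + c * poisson_E mu G.
Proof.
move=> mu0 tF tG.
have tFG : tame (fun k => b * F k + c * G k) by apply: tame_add; exact: tame_scale.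
apply: (@cvg_unique _ (@Rhausdorff R) _ _ _ _ (poisson_E_lim mu0 tFG)).
rewrite [X in X @ _](_ : _ = (fun n => b * series (fun k => poisson_pmf mu k * F k) n
   + c * series (fun k => poisson_pmf mu k * G k) n)); last first.
  apply/funext => n; rewrite /series/= !mulr_sumr -big_split/=.
  by apply: eq_bigr => k _; ring.
by apply: cvgD; apply: cvgMr; exact: poisson_E_lim.
Qed.

Lemma poisson_E_scale mu (b : R) F : 0 < mu -> tame F ->
  poisson_E mu (fun k => b * F k) = b * poisson_E mu F.
Proof.
move=> mu0 tF; have := @poisson_E_lin mu b 0 F F mu0 tF tF.
by rewrite mul0r addr0 => <-; congr poisson_E; apply/funext => k; rewrite mul0r addr0.
Qed.

Lemma poisson_E_add mu F G : 0 < mu -> tame F -> tame G ->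
  poisson_E mu (fun k => F k + G k) = poisson_E mu F + poisson_E mu G.
Proof.
move=> mu0 tF tG; have := @poisson_E_lin mu 1 1 F G mu0 tF tG.
by rewrite !mul1r => <-; congr poisson_E; apply/funext => k; rewrite !mul1r.
Qed.

Lemma poisson_E_cst mu (c : R) : poisson_E mu (fun=> c) = c.
Proof. by rewrite /poisson_E (expectation_cst _ c). Qed.

Lemma poisson_E_le mu F G : 0 < mu -> tame F -> tame G ->
  (forall k, F k <= G k) -> poisson_E mu F <= poisson_E mu G.
Proof.
move=> mu0 tF tG FG.
apply: (ler_cvg_to (poisson_E_lim mu0 tF) (poisson_E_lim mu0 tG)).
apply: nearW => n; apply: ler_sum => k _.
by rewrite ler_wpM2l// poisson_pmf_ge0.
Qed.

Lemma poisson_E_norm_le mu F G : 0 < mu -> tame F -> tame G ->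
  (forall k, `|F k| <= G k) -> `|poisson_E mu F| <= poisson_E mu G.
Proof.
move=> mu0 tF tG FG; rewrite ler_norml; apply/andP; split.
  rewrite -mulN1r -poisson_E_scale//; apply: poisson_E_le => //.
    exact: tame_scale.
  by move=> k; rewrite mulN1r; have := FG k; rewrite ler_norml => /andP[].
by apply: poisson_E_le => // k; exact: le_trans (ler_norm _) (FG k).
Qed.

Lemma poisson_partial_le mu F n : 0 < mu -> tame F -> (forall k, 0 <= F k) ->
  \sum_(k < n) poisson_pmf mu k * F k <= poisson_E mu F.
Proof.
move=> mu0 tF F0; have cE := poisson_E_lim mu0 tF.
rewrite -(big_mkord xpredT (fun k => poisson_pmf mu k * F k)).
rewrite -(cvg_lim (@Rhausdorff R) cE); apply: nondecreasing_cvgn_le; last first.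
  by apply/cvg_ex; exists (poisson_E mu F).
apply/nondecreasing_seqP => k; rewrite seriesSr lerDl.
by rewrite mulr_ge0// poisson_pmf_ge0.
Qed.

Lemma poisson_partial_le1 mu n : 0 < mu -> \sum_(j < n) poisson_pmf mu j <= 1.
Proof.
move=> mu0; have := poisson_partial_le n mu0 (tame_cst 1) (fun=> ler01).
by rewrite poisson_E_cst; under eq_bigr do rewrite mulr1.
Qed.

(** From (k + 1) P(k + 1) = mu P(k); all the polynomial moments follow from
    it. *)
Lemma poisson_E_shift mu F : 0 < mu -> tame F -> tame (fun k => F k.+1) ->
  poisson_E mu (fun k => k%:R * F k) = mu * poisson_E mu (fun k => F k.+1).
Proof.
move=> mu0 tF tF1.
have tkF : tame (fun k => k%:R * F k) by apply: tame_mul => //; exact: tame_id.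
have := poisson_E_lim mu0 tkF; rewrite -cvg_shiftS => h.
apply: (@cvg_unique _ (@Rhausdorff R) _ _ _ _ h).
rewrite [X in X @ _](_ : _ = (fun n => mu * series (fun k => poisson_pmf mu k * F k.+1) n)).
  by apply: cvgMr; exact: poisson_E_lim.
apply/funext => n; rewrite /series/= big_nat_recl//= mul0r mulr0 add0r mulr_sumr.
apply: eq_bigr => k _; rewrite !poisson_pmfE// exprS factS natrM.
field; rewrite !pnatr_eq0 -lt0n fact_gt0/=.
by rewrite nat1r pnatr_eq0.
Qed.

Lemma poisson_E_id (mu : R) : 0 < mu -> poisson_E mu (fun k => k%:R) = mu.
Proof.
move=> mu0; have := poisson_E_shift mu0 (tame_cst 1) (tame_cst 1).
rewrite poisson_E_cst mulr1 => {2}<-.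
by congr poisson_E; apply: funext => k; rewrite mulr1.
Qed.

Lemma poisson_E_sqr (mu : R) : 0 < mu -> poisson_E mu (fun k => k%:R ^+ 2) = mu + mu ^+ 2.
Proof.
move=> mu0.
have sE : (fun k : nat => k.+1%:R) = (fun k : nat => k%:R + 1) :> (nat -> R).
  by apply/funext => k; rewrite natr1.
have t1 : tame (fun k => k.+1%:R : R).
  by rewrite sE; apply: tame_add; [exact: tame_id|exact: tame_cst].
have -> : poisson_E mu (fun k => k%:R ^+ 2) = poisson_E mu (fun k => k%:R * k%:R).
  by congr poisson_E.
rewrite (poisson_E_shift mu0 tame_id t1) sE.
rewrite poisson_E_add ?poisson_E_cst ?poisson_E_id//; first by ring.
- exact: tame_id.
- exact: tame_cst.
Qed.

Lemma poisson_E_pmf mu j : 0 < mu ->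
  poisson_E mu (fun k => (k == j)%:R) = poisson_pmf mu j.
Proof.
move=> mu0.
have t : tame (fun k => (k == j)%:R).
  apply: (tame_le (tame_cst 1)) => k; rewrite normr1 normr_nat lern1.
  by case: (_ == _).
apply: (@cvg_unique _ (@Rhausdorff R) _ _ _ _ (poisson_E_lim mu0 t)).
apply: cvg_near_cst; near=> n; rewrite /series/= big_mkord.
have jn : (j < n)%N by near: n; exists j.+1.
rewrite (bigD1 (Ordinal jn))//= eqxx mulr1 big1 ?addr0// => i /eqP ij.
case: eqP => [e|]; last by rewrite mulr0.
by exfalso; apply: ij; apply: val_inj.
Unshelve. all: by end_near.
Qed.

(** For small mu the values 0, 1 and 2 decide the leading orders; the part of
    the function seen by larger counts contributes O(mu^3). *)
Definition tail3 F k := if (k < 3)%N then 0 else F k.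

Lemma tame_tail3 F : tame F -> tame (tail3 F).
Proof.
by move=> tF; apply: (tame_le tF) => k; rewrite /tail3; case: ifP; rewrite ?normr0.
Qed.

Lemma poisson_E_split3 mu F : 0 < mu -> tame F ->
  poisson_E mu F = poisson_pmf mu 0 * F 0%N + poisson_pmf mu 1 * F 1%N
     + poisson_pmf mu 2 * F 2%N + poisson_E mu (tail3 F).
Proof.
move=> mu0 tF.
have t j : tame (fun k => (k == j)%:R).
  apply: (tame_le (tame_cst 1)) => k; rewrite normr1 normr_nat lern1.
  by case: (_ == _).
rewrite -!poisson_E_pmf// mulrC (mulrC _ (F 1%N)) (mulrC _ (F 2%N)).
rewrite -poisson_E_lin// -poisson_E_scale// -!poisson_E_add//; last first.
all: try by do ?[exact: tame_tail3|apply: tame_scale|apply: tame_add].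
congr poisson_E; apply/funext => -[|[|[|k]]]; rewrite /tail3/= ?mulr0 ?mulr1 ?add0r ?addr0//.
Qed.

Lemma poisson_E_tail3 mu a F : 0 < mu -> mu <= 1 -> geom_bounded a F ->
  `|poisson_E mu (tail3 F)| <= a * expR a * mu ^+ 3.
Proof.
move=> mu0 mu1 aF; have a0 := geom_ge0 aF.
have aF' : geom_bounded a (tail3 F).
  by move=> k; rewrite /tail3; case: ifP => // _; rewrite normr0 exprn_ge0.
have /cvg_norm h := poisson_E_cvg mu0 aF'.
have h2 : (a * mu ^+ 3) *: series (exp_coeff a) @ \oo --> (a * mu ^+ 3) *: expR a.
  by apply: cvgZr => //; exact: is_cvg_series_exp_coeff.
rewrite mulrAC; apply: (ler_cvg_to h h2); apply: nearW => n /=.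
rewrite -[leRHS]/(a * mu ^+ 3 * _) /series/= mulr_sumr.
apply: le_trans (ler_norm_sum _ _ _) _; apply: ler_sum => k _.
rewrite /tail3; case: ifP => [_|/negbT]; rewrite ?mulr0 ?normr0.
  by rewrite !mulr_ge0// ?exprn_ge0// ?(ltW mu0)// exp_coeff_ge0.
rewrite -leqNgt => k3; apply: le_trans (geom_pmf_bound k mu0 aF) _.
rewrite -!mulrA ler_wpM2l// /exp_coeff/= exprMn.
rewrite [leLHS](_ : _ = (a ^+ k / k`!%:R) * (expR (- mu) * mu ^+ k)); last by ring.
rewrite [leRHS](_ : _ = (a ^+ k / k`!%:R) * mu ^+ 3); last by ring.
rewrite ler_wpM2l ?divr_ge0 ?exprn_ge0//.
rewrite -[leRHS]mul1r ler_pM ?expR_ge0 ?exprn_ge0 ?(ltW mu0)//.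
  by rewrite expR_le1 oppr_le0 ltW.
by rewrite ler_wiXn2l ?(ltW mu0).
Qed.

(** A function vanishing at 0 and 1 is felt through pairs only, and
    P(xi = 2) = mu^2 / 2 + O(mu^3). *)
Lemma poisson_E_order2 F : tame F -> F 0%N = 0 -> F 1%N = 0 ->
  exists2 C, 0 <= C & forall mu, 0 < mu -> mu <= 1 ->
    `|poisson_E mu F - F 2%N / 2 * mu ^+ 2| <= C * mu ^+ 3.
Proof.
move=> tF F0 F1; have [a a1 aF] := tF; have a0 : 0 <= a by exact: le_trans a1.
exists (`|F 2%N| / 2 + a * expR a).
  by rewrite addr_ge0 ?mulr_ge0 ?expR_ge0// invr_ge0.
move=> mu mu0 mu1; rewrite poisson_E_split3// F0 F1 !mulr0 !add0r.
rewrite poisson_pmfE// (_ : 2`! = 2)%N//.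
rewrite [X in `|X|](_ : _ = - (F 2%N / 2 * mu ^+ 2 * (1 - expR (- mu)))
    + poisson_E mu (tail3 F)); last by field.
apply: le_trans (ler_normD _ _) _; rewrite mulrDl lerD ?poisson_E_tail3//.
rewrite normrN !normrM (@ger0_norm _ 2^-1) ?invr_ge0//.
rewrite (gtr0_norm mu0) -expr2 [leRHS](_ : _ = `|F 2%N| / 2 * mu ^+ 2 * mu); last by ring.
rewrite ler_wpM2l//.
  by rewrite !mulr_ge0 ?exprn_ge0 ?invr_ge0// ltW.
rewrite ger0_norm; last by rewrite subr_ge0 expR_le1 oppr_le0 ltW.
by rewrite lerBlDl -lerBlDr; exact: expR_ge1Dx.
Qed.

End PoissonSeries.

(** * Elementary bounds for the exponential *)

Section ExpBounds.
Context {R : realType}.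
Implicit Types (u x : R).

Lemma expR_le_quad u : `|u| <= 2^-1 -> expR u <= 1 + u + 2 * u ^+ 2.
Proof.
rewrite ler_norml => /andP[u1 u2].
have h : 1 - u <= expR (- u) by have := expR_ge1Dx (- u).
have h0 : 0 < 1 - u by lra.
rewrite -[expR u]invrK -expRN; apply: (@le_trans _ _ (1 - u)^-1).
  by rewrite lef_pV2 ?posrE ?expR_gt0.
rewrite -div1r ler_pdivrMr//; nra.
Qed.

Lemma expR_quad u : `|u| <= 2^-1 -> `|expR u - 1 - u| <= 2 * u ^+ 2.
Proof.
move=> u1; rewrite ler_norml; apply/andP; split.
  by have := expR_ge1Dx u; have := sqr_ge0 u; lra.
by have := expR_le_quad u1; lra.
Qed.

Lemma expR_sub1 u : `|u| <= 2^-1 -> `|expR u - 1| <= 2 * `|u|.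
Proof.
move=> u1; rewrite (_ : expR u - 1 = (expR u - 1 - u) + u); last by ring.
apply: le_trans (ler_normD _ _) _.
have := expR_quad u1; rewrite -[u ^+ 2]real_normK ?num_real//.
by have := normr_ge0 u; nra.
Qed.

Lemma expR_le_cubic (u : R) : 0 <= u -> u <= 1 ->
  expR u <= 1 + u + u ^+ 2 / 2 + expR 2 * u ^+ 3.
Proof.
rewrite le_eqVlt => /orP[/eqP <-|u0 u1].
  by rewrite expR0 !expr0n/= mul0r mulr0 !addr0.
have g1 : geom_bounded (1 : R) (fun=> 1) by move=> k; rewrite normr1 expr1n.
have := poisson_E_tail3 u0 u1 g1.
have := poisson_E_split3 u0 (tame_cst 1); rewrite poisson_E_cst !poisson_pmfE// !mulr1.
rewrite expr0 expr1 (_ : 2`! = 2)%N// (_ : 1`! = 1)%N// (_ : 0`! = 1)%N// !divr1.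
set T := poisson_E _ _ => e; rewrite mul1r => /ler_normlW hT.
have eu : expR (- u) * expR u = 1 by rewrite -expRD addNr expR0.
have -> : expR u = 1 + u + u ^+ 2 / 2 + expR u * T.
  rewrite -[LHS]mulr1 [X in _ * X = _]e mulrDr; congr (_ + _).
  rewrite (_ : _ * _ = (expR (- u) * expR u) * (1 + u + u ^+ 2 / 2)); last by ring.
  by rewrite eu mul1r.
rewrite lerD2l; apply: (@le_trans _ _ (expR u * (expR 1 * u ^+ 3))).
  by rewrite ler_wpM2l ?expR_ge0.
rewrite mulrA ler_wpM2r ?exprn_ge0 ?(ltW u0)// (_ : 2 = 1 + 1)// expRD.
by rewrite ler_wpM2r ?expR_ge0// ler_expR.
Qed.

Lemma expR_ge_quad (u : R) : 0 <= u -> 1 + u + u ^+ 2 / 2 <= expR u.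
Proof.
rewrite le_eqVlt => /orP[/eqP <-|u0].
  by rewrite expR0 !expr0n/= mul0r !addr0.
have := poisson_E_split3 u0 (tame_cst 1); rewrite poisson_E_cst !poisson_pmfE// !mulr1.
rewrite expr0 expr1 (_ : 2`! = 2)%N// (_ : 1`! = 1)%N// (_ : 0`! = 1)%N// !divr1.
have T0 : 0 <= poisson_E u (tail3 (fun=> 1)).
  rewrite -(poisson_E_cst u 0); apply: poisson_E_le => //.
  - exact: tame_cst.
  - by apply: tame_tail3; exact: tame_cst.
  - by move=> k; rewrite /tail3; case: ifP.
move=> e; have : (1 + u + u ^+ 2 / 2) * expR (- u) <= 1 by rewrite mul1r in e; lra.
by rewrite expRN ler_pdivrMr ?expR_gt0// mul1r.
Qed.

(** A second-order bound valid for all x >= 0, for counts that are rare enough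
    not to need a sharp constant. *)
Lemma expR_le_exp_mul (x : R) : 0 <= x -> expR x <= 1 + x + x ^+ 2 * expR x.
Proof.
move=> x0; have := expR_ge1Dx (- x); rewrite expRN => h.
have e0 := expR_gt0 x.
have : (1 - x) * expR x <= 1 by rewrite -ler_pdivlMr// div1r.
nra.
Qed.

(** This is ln (1 + y) >= y - 2 y^2, in the form used to bound N-th powers from
    below. *)
Lemma expR_log_lower (y : R) : 0 <= y -> y <= 2^-1 -> expR (y - 2 * y ^+ 2) <= 1 + y.
Proof.
move=> y0 y1; have h : `|y - 2 * y ^+ 2| <= y.
  rewrite ler_norml; apply/andP; split; nra.
apply: le_trans (expR_le_quad (le_trans h y1)) _.
have : (y - 2 * y ^+ 2) ^+ 2 <= y ^+ 2.
  by rewrite -[leLHS]real_normK ?num_real// lerXn2r ?nnegrE.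
lra.
Qed.

Lemma expr1D_quad x k : `|x| <= 2^-1 ->
  `|(1 + x) ^+ k - 1 - k%:R * x| <= 3 ^+ k * x ^+ 2.
Proof.
move=> x1; elim: k => [|k IH].
  by rewrite expr0 subrr mul0r subrr normr0 mul1r sqr_ge0.
rewrite (_ : _ - _ = (1 + x) * ((1 + x) ^+ k - 1 - k%:R * x) + k%:R * x ^+ 2); last first.
  by rewrite -natr1 exprS; ring.
apply: le_trans (ler_normD _ _) _; rewrite normrM (normrM k%:R) normr_nat.
rewrite (ger0_norm (sqr_ge0 x)) (exprS 3).
have k3 : k%:R <= 3 ^+ k :> R by rewrite -natrX ler_nat ltnW// ltn_expl.
have h1 : `|1 + x| <= 3 / 2.
  by apply: le_trans (ler_normD _ _) _; rewrite normr1; lra.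
have := ler_pM (normr_ge0 _) (normr_ge0 _) h1 IH.
have := ler_wpM2r (sqr_ge0 x) k3.
have : 0 <= (3 : R) ^+ k * x ^+ 2 by rewrite mulr_ge0 ?sqr_ge0 ?exprn_ge0.
lra.
Qed.

End ExpBounds.

(** * Second-order expansion of a Poisson mean in its parameter *)

Section MeanShift.
Context {R : realType}.
Implicit Types (mu x : R) (F : nat -> R).

(** Poisson(mu (1 + x)) has the density (1 + x)^k exp (- mu x) with respect to
    Poisson(mu), so a change of parameter becomes a change of integrand. *)
Lemma poisson_E_tilt mu x F : 0 < mu -> 0 < 1 + x -> tame F ->
  poisson_E (mu * (1 + x)) F =
  poisson_E mu (fun k => F k * ((1 + x) ^+ k * expR (- (mu * x)))).
Proof.
move=> mu0 x0 tF.
have t : tame (fun k => F k * ((1 + x) ^+ k * expR (- (mu * x)))).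
  by apply: tame_mul => //; apply: tame_mul; [exact: tame_exp|exact: tame_cst].
have := poisson_E_lim mu0 t; apply: cvg_unique; first exact: Rhausdorff.
rewrite [X in X @ _](_ : _ = series (fun k => poisson_pmf (mu * (1 + x)) k * F k)).
  by apply: poisson_E_lim => //; exact: mulr_gt0.
congr series; apply/funext => k; rewrite !poisson_pmfE ?mulr_gt0//.
by rewrite exprMn mulrDr mulr1 opprD expRD; ring.
Qed.

(** The density of Poisson(mu (1 + x)) with respect to Poisson(mu), minus its
    first-order Taylor polynomial in x. *)
Definition tilt_rem (mu x : R) k :=
  (1 + x) ^+ k * expR (- (mu * x)) - 1 - (k%:R - mu) * x.

Lemma tilt_rem_bound mu x k : 0 < mu -> mu <= 1 -> `|x| <= 2^-1 ->
  `|tilt_rem mu x k| <= 6 ^+ k.+1 * x ^+ 2.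
Proof.
move=> mu0 mu1 x1; set y := mu * x.
have yx : `|y| <= `|x| by rewrite normrM (gtr0_norm mu0) ler_piMl.
have y1 : `|- y| <= 2^-1 by rewrite normrN; exact: le_trans x1.
have y2 : y ^+ 2 <= x ^+ 2.
  by rewrite -[y ^+ 2]real_normK ?num_real// -[x ^+ 2]real_normK ?num_real// lerXn2r ?nnegrE.
have := expR_quad y1; rewrite sqrrN => hq.
have := expR_sub1 y1; rewrite normrN => hs.
have he : expR (- y) <= 2.
  apply: le_trans (expR_le_quad y1) _; move: y1; rewrite normrN ler_norml => /andP[]; nra.
pose Rk := (1 + x) ^+ k - 1 - k%:R * x.
have hR : `|Rk| <= 3 ^+ k * x ^+ 2 := expr1D_quad k x1.
rewrite (_ : tilt_rem _ _ _ = Rk * expR (- y) + (expR (- y) - 1 - (- y))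
   + (k%:R * x) * (expR (- y) - 1)); last by rewrite /tilt_rem /Rk /y; ring.
have k3 : k%:R <= 3 ^+ k :> R by rewrite -natrX ler_nat ltnW// ltn_expl.
have k1 : 1 <= 3 ^+ k :> R by rewrite exprn_ege1// ler1n.
have k6 : 3 ^+ k <= 6 ^+ k :> R by rewrite lerXn2r ?nnegrE// ler_nat.
have x20 := sqr_ge0 x.
apply: (@le_trans _ _ (3 ^+ k * x ^+ 2 * 2 + 2 * x ^+ 2 + 3 ^+ k * `|x| * (2 * `|x|))).
  apply: le_trans (ler_normD _ _) _; apply: lerD; last first.
    rewrite normrM; apply: ler_pM => //.
      by rewrite normrM normr_nat ler_wpM2r.
    by apply: le_trans hs _; rewrite ler_wpM2l.
  apply: le_trans (ler_normD _ _) _; apply: lerD.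
    by rewrite normrM (gtr0_norm (expR_gt0 _)) ler_pM ?expR_ge0.
  by apply: le_trans hq _; rewrite ler_wpM2l.
have ex : `|x| * `|x| = x ^+ 2 by rewrite -expr2 real_normK ?num_real.
rewrite (exprS 6); have : 1 * x ^+ 2 <= 3 ^+ k * x ^+ 2 by rewrite ler_wpM2r.
have : 3 ^+ k * x ^+ 2 <= 6 ^+ k * x ^+ 2 by rewrite ler_wpM2r.
rewrite (_ : 3 ^+ k * `|x| * (2 * `|x|) = 2 * (3 ^+ k * x ^+ 2)); first by lra.
by rewrite -ex; ring.
Qed.

Lemma tilt_rem_two mu x : 0 < mu -> mu <= 1 -> `|x| <= 2^-1 ->
  `|tilt_rem mu x 2 - x ^+ 2| <= 7 * mu * x ^+ 2.
Proof.
move=> mu0 mu1 x1; set y := mu * x.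
have yx : `|y| <= `|x| by rewrite normrM (gtr0_norm mu0) ler_piMl.
have y1 : `|- y| <= 2^-1 by rewrite normrN; exact: le_trans x1.
have := expR_quad y1; rewrite sqrrN; set r := expR (- y) - 1 - (- y) => hr.
rewrite (_ : _ - _ = - (mu * x ^+ 2 * (2 + x)) + (1 + x) ^+ 2 * r); last first.
  by rewrite /tilt_rem /r -/y /y; ring.
apply: le_trans (ler_normD _ _) _.
have [xl xu] : - 2^-1 <= x /\ x <= 2^-1 by move: x1; rewrite ler_norml => /andP[].
have m0 : 0 <= mu * x ^+ 2 by rewrite mulr_ge0 ?sqr_ge0// ltW.
apply: (@le_trans _ _ (mu * x ^+ 2 * (5 / 2) + 9 / 4 * (2 * (mu * x ^+ 2)))).
  apply: lerD.
    rewrite normrN normrM ger0_norm// ler_wpM2l// ger0_norm; lra.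
  rewrite normrM; apply: ler_pM => //.
    by rewrite ger0_norm ?sqr_ge0//; nra.
  apply: le_trans hr _; rewrite ler_wpM2l// /y exprMn ler_wpM2r ?sqr_ge0//.
  by rewrite expr2 ler_piMl// ltW.
lra.
Qed.

(** Pairs give the second-order term, because their density has quadratic
    coefficient 1 + O(mu) in x; larger counts carry an extra factor mu.  The
    error keeps the factor x^2: summed over the cells the main term has order
    lam^2 N e, and an error of order lam^3 N could exceed it. *)
Lemma poisson_mean_shift F : tame F -> F 0%N = 0 -> F 1%N = 0 ->
  exists2 C, 0 <= C & forall mu, 0 < mu -> mu <= 1 -> exists2 c,
    `|c| <= C * mu ^+ 2 & forall x, `|x| <= 2^-1 ->
    `|poisson_E (mu * (1 + x)) F - poisson_E mu F - c * x
       - F 2%N / 2 * mu ^+ 2 * x ^+ 2| <= C * mu ^+ 3 * x ^+ 2.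
Proof.
move=> tF F0 F1.
have tF1 : tame (fun k => `|F k| * (k%:R + 1)).
  apply: tame_mul; first by apply: (tame_le tF) => k; rewrite normr_id.
  by apply: tame_add; [exact: tame_id|exact: tame_cst].
have [C1 C10 hC1] := poisson_E_order2 tF1 (ltac:(by rewrite /= F0 normr0 mul0r))
  (ltac:(by rewrite /= F1 normr0 mul0r)).
have [a a1 aF] := tF; have a0 : 0 <= a by exact: le_trans a1.
pose C2 := a * 6 * expR (a * 6).
have C20 : 0 <= C2 by rewrite !mulr_ge0 ?expR_ge0.
exists (`|F 2%N| * 4 + C2 + C1); first by rewrite !addr_ge0// mulr_ge0.
move=> mu mu0 mu1.
have tc : tame (fun k => F k * (k%:R - mu)).
  by apply: tame_mul => //; apply: tame_add; [exact: tame_id|exact: tame_cst].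
exists (poisson_E mu (fun k => F k * (k%:R - mu))).
  apply: (@le_trans _ _ (poisson_E mu (fun k => `|F k| * (k%:R + 1)))).
    apply: poisson_E_norm_le => // k; rewrite normrM ler_wpM2l//.
    rewrite ler_norml; apply/andP; split; have := ler0n R k; lra.
  have := hC1 mu mu0 mu1; rewrite ler_norml => /andP[_].
  have m2 := sqr_ge0 mu.
  have : C1 * mu ^+ 3 <= C1 * mu ^+ 2 by rewrite ler_wpM2l// ler_wiXn2l// ltW.
  rewrite -[`|F 2%N| * (2%:R + 1)]/(`|F 2%N| * (2 + 1)).
  have : 0 <= `|F 2%N| * mu ^+ 2 by rewrite mulr_ge0.
  have : 0 <= C2 * mu ^+ 2 by rewrite mulr_ge0.
  by move=> *; lra.
move=> x x1.
have x10 : 0 < 1 + x by move: x1; rewrite ler_norml => /andP[]; lra.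
have [->|xn0] := eqVneq x 0.
  by rewrite addr0 mulr1 subrr mulr0 expr0n/= !mulr0 !subr0 normr0.
have x20 : 0 < x ^+ 2 by rewrite exprn_even_gt0.
pose D k := F k * (tilt_rem mu x k / x ^+ 2).
have gD : geom_bounded (a * 6) D.
  move=> k; rewrite /D normrM exprMn ler_pM// normrM normfV (gtr0_norm x20).
  by rewrite ler_pdivrMr//; exact: tilt_rem_bound.
have tD : tame D by exists (a * 6) => //; lra.
have -> : poisson_E (mu * (1 + x)) F = poisson_E mu F
     + (x * poisson_E mu (fun k => F k * (k%:R - mu)) + x ^+ 2 * poisson_E mu D).
  rewrite poisson_E_tilt// -poisson_E_lin// -poisson_E_add//; last first.
    by apply: tame_add; exact: tame_scale.
  congr poisson_E; apply/funext => k; rewrite /D /tilt_rem; field.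
  by rewrite xn0.
have := poisson_E_tail3 mu0 mu1 gD; rewrite -/C2 => hT.
rewrite (poisson_E_split3 mu0 tD) {1 2}/D F0 F1 !mul0r !mulr0 !add0r.
set T := poisson_E mu (tail3 D) in hT *.
set p2 := poisson_pmf mu 2.
have p2E : p2 = mu ^+ 2 / 2 * expR (- mu) by rewrite /p2 poisson_pmfE.
have p2u : p2 <= mu ^+ 2 / 2.
  rewrite p2E ler_piMr ?expR_le1 ?oppr_le0 ?(ltW mu0)//.
  by rewrite divr_ge0 ?sqr_ge0.
have p20 : 0 <= p2 by rewrite ltW// poisson_pmf_gt0.
have p2l : mu ^+ 2 / 2 - mu ^+ 3 / 2 <= p2.
  rewrite p2E (_ : _ - _ = mu ^+ 2 / 2 * (1 - mu)); last by field.
  rewrite ler_wpM2l ?divr_ge0 ?sqr_ge0//; exact: expR_ge1Dx.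
rewrite (_ : _ - _ = F 2%N * (p2 * (tilt_rem mu x 2 - x ^+ 2) + (p2 - mu ^+ 2 / 2) * x ^+ 2)
    + x ^+ 2 * T); last by rewrite /D; field; rewrite xn0.
apply: le_trans (ler_normD _ _) _.
rewrite normrM (normrM (x ^+ 2)) (gtr0_norm x20).
have h1 : `|p2 * (tilt_rem mu x 2 - x ^+ 2) + (p2 - mu ^+ 2 / 2) * x ^+ 2| <= 4 * mu ^+ 3 * x ^+ 2.
  apply: (@le_trans _ _ (mu ^+ 2 / 2 * (7 * mu * x ^+ 2) + mu ^+ 3 / 2 * x ^+ 2)); last by lra.
  apply: le_trans (ler_normD _ _) _; apply: lerD; rewrite normrM.
    by rewrite (ger0_norm p20) ler_pM//; exact: tilt_rem_two.
  rewrite (gtr0_norm x20) ler_wpM2r// ?(ltW x20)//.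
  by rewrite ler_norml; apply/andP; split; have := exprn_gt0 3 mu0; lra.
have h2 : `|F 2%N| * `|p2 * (tilt_rem mu x 2 - x ^+ 2) + (p2 - mu ^+ 2 / 2) * x ^+ 2|
   <= `|F 2%N| * (4 * mu ^+ 3 * x ^+ 2) by rewrite ler_wpM2l.
have h3 : x ^+ 2 * `|T| <= x ^+ 2 * (C2 * mu ^+ 3) by rewrite ler_wpM2l// ltW.
have : 0 <= C1 * mu ^+ 3 * x ^+ 2.
  by rewrite mulr_ge0 ?(ltW x20)// mulr_ge0// exprn_ge0// ltW.
lra.
Qed.

End MeanShift.

(** * Monotonicity in the number of balls and Poisson mixtures *)

Section Mixture.
Context {R : realType} {N : nat}.
Implicit Types (L n j : nat) (mu : R) (A : pred ('I_N -> nat)).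

Definition upclosed A := forall k k' : 'I_N -> nat,
  (forall m, k m <= k' m)%N -> A k -> A k'.

Definition counts L (k : {ffun 'I_N -> 'I_L.+1}) : 'I_N -> nat := fun m => k m.

Lemma upclosed_ext A (k k' : 'I_N -> nat) : upclosed A -> k =1 k' -> A k = A k'.
Proof. by move=> uA e; apply/idP/idP; apply: uA => m; rewrite e. Qed.

Definition urn_weight L (k : {ffun 'I_N -> 'I_L.+1}) : R := \prod_m ((k m)`!%:R)^-1.

(** The cap L on the counts is common to all numbers of balls j <= L, so that
    urns with different j live on the same finite type. *)
Definition urn_sum L j A : R :=
  \sum_(k : {ffun 'I_N -> 'I_L.+1} | (\sum_m k m == j)%N && A (counts k))
     urn_weight k.

Definition urn_prob L j A : R := j`!%:R / N%:R ^+ j * urn_sum L j A.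

Lemma urn_weight_ge0 L (k : {ffun 'I_N -> 'I_L.+1}) : 0 <= urn_weight k.
Proof. by apply: prodr_ge0 => m _. Qed.

Lemma urn_sum_cap L j A : upclosed A -> (j <= L)%N -> urn_sum L j A = urn_sum j j A.
Proof.
move=> uA jL.
pose up (k : {ffun 'I_N -> 'I_j.+1}) : {ffun 'I_N -> 'I_L.+1} := [ffun m => inord (k m)].
pose dn (k : {ffun 'I_N -> 'I_L.+1}) : {ffun 'I_N -> 'I_j.+1} := [ffun m => inord (k m)].
have upE k m : up k m = k m :> nat.
  by rewrite ffunE inordK// ltnS (leq_trans _ jL)// -ltnS.
have dnE (k : {ffun 'I_N -> 'I_L.+1}) m : (\sum_m k m == j)%N -> dn k m = k m :> nat.
  by move=> /eqP kj; rewrite ffunE inordK// ltnS -kj (bigD1 m)//= leq_addr.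
rewrite /urn_sum (reindex_onto up dn); last first.
  by move=> k /andP[kj _]; apply/ffunP => m; apply: val_inj; rewrite /= upE dnE.
apply: eq_big => [k|k _]; last by apply: eq_bigr => m _; rewrite upE.
have e : counts (up k) =1 counts k by move=> m; rewrite /counts upE.
rewrite (upclosed_ext uA e) (eq_bigr (fun m => k m : nat)) => [|m _]; last by rewrite upE.
case: eqP => //= kj; case: (A _) => //=; apply/eqP/ffunP => m; apply: val_inj.
rewrite /= dnE ?upE// (eq_bigr (fun m => k m : nat)) ?kj//.
Qed.

Lemma urn_probE n A : upclosed A ->
  multinomial_prob n (fun _ => N%:R^-1 : R) A = urn_prob n n A.
Proof.
move=> uA; rewrite /multinomial_prob /urn_prob /urn_sum mulr_sumr.
rewrite [LHS](bigID (fun k : {ffun 'I_N -> 'I_n.+1} => (\sum_m k m == n)%N))/=.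
rewrite [X in _ + X]big1 ?addr0; last first.
  by move=> k /andP[_ /negbTE h]; rewrite /multinomial_pmf h.
apply: eq_big => [k|k /andP[_ h]]; first by rewrite andbC.
rewrite /multinomial_pmf h /urn_weight natr_prod prodfV -mulrA [RHS]mulrAC -[RHS]mulrA.
congr (_ * _); congr (_ * _).
under eq_bigr do rewrite exprVn; rewrite prodfV prodrXr.
by rewrite (eqP h).
Qed.

(** Since k_m / k_m! = 1 / (k_m - 1)!, multiplying the weight of a vector of
    total j + 1 by its total spreads it over the vectors obtained by removing
    one ball; an increasing event holds after adding that ball back. *)
Lemma urn_sum_add_ball L j A : upclosed A -> (j < L)%N ->
  N%:R * urn_sum L j A <= j.+1%:R * urn_sum L j.+1 A.
Proof.
move=> uA jL.
have -> : j.+1%:R * urn_sum L j.+1 A =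
  \sum_(m < N) \sum_(k : {ffun 'I_N -> 'I_L.+1} | (\sum_i k i == j.+1)%N && A (counts k))
     (k m)%:R * urn_weight k.
  rewrite exchange_big/= /urn_sum mulr_sumr; apply: eq_bigr => k /andP[/eqP kj _].
  by rewrite -mulr_suml -natr_sum kj.
rewrite mulr_natl -[X in _ *+ X](card_ord N) -sumr_const; apply: ler_sum => m _.
pose inc (k : {ffun 'I_N -> 'I_L.+1}) : {ffun 'I_N -> 'I_L.+1} :=
  [ffun i => inord (k i + (i == m))].
pose dec (k : {ffun 'I_N -> 'I_L.+1}) : {ffun 'I_N -> 'I_L.+1} :=
  [ffun i => inord (k i - (i == m))].
have decE k i : dec k i = (k i - (i == m))%N :> nat.
  by rewrite ffunE inordK// ltnS (leq_trans (leq_subr _ _))// -ltnS.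
rewrite (bigID (fun k : {ffun 'I_N -> 'I_L.+1} => 0 < k m)%N)/=.
rewrite [X in _ <= _ + X]big1 ?addr0; last first.
  by move=> k /andP[_]; rewrite lt0n negbK => /eqP ->; rewrite mul0r.
rewrite (reindex_onto inc dec)/=; last first.
  move=> k /andP[_ km]; apply/ffunP => i; apply: val_inj; rewrite /= ffunE decE.
  rewrite subnK ?inordK//.
  by case: eqP => // ->.
rewrite /urn_sum big_mkcond [leRHS]big_mkcond; apply: ler_sum => k _.
case: ifP => [/andP[/eqP kj Ak]|_]; last first.
  by case: ifP => // _; rewrite mulr_ge0// urn_weight_ge0.
have incE i : inc k i = (k i + (i == m))%N :> nat.
  rewrite ffunE inordK// ltnS; case: eqP => [->|_]; last by rewrite addn0 -ltnS.
  by rewrite addn1 (leq_ltn_trans _ jL)// -kj (bigD1 m)//= leq_addr.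
rewrite ifT.
  rewrite /urn_weight (bigD1 m)//= [in leRHS](bigD1 m)//= incE eqxx addn1.
  rewrite factS natrM invfM !mulrA mulfV ?pnatr_eq0// mul1r le_eqVlt; apply/orP; left.
  apply/eqP; congr (_ * _); apply: eq_bigr => i /negbTE im.
  by rewrite incE im addn0.
apply/andP; split; last first.
  by apply/eqP/ffunP => i; apply: val_inj; rewrite /= decE incE addnK.
apply/andP; split; last by rewrite incE eqxx addn1.
apply/andP; split; last first.
  by apply: uA Ak => i; rewrite /counts incE leq_addr.
rewrite (eq_bigr (fun i => k i + (i == m))%N) => [|i _]; last by rewrite incE.
rewrite big_split/= kj (bigD1 m)//= eqxx big1 ?addn0 ?addn1// => i /negbTE ->.
by [].
Qed.

Lemma urn_sum_ge0 L j A : 0 <= urn_sum L j A.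
Proof. by apply: sumr_ge0 => k _; exact: urn_weight_ge0. Qed.

Lemma urn_prob_ge0 L j A : 0 <= urn_prob L j A.
Proof. by rewrite mulr_ge0 ?urn_sum_ge0// divr_ge0// exprn_ge0. Qed.

Context (N0 : (0 < N)%N).

Lemma urn_prob_mono L j j' A : upclosed A -> (j <= j')%N -> (j' <= L)%N ->
  urn_prob L j A <= urn_prob L j' A.
Proof.
move=> uA; elim: j' => [|j' IH]; first by rewrite leqn0 => /eqP ->.
rewrite leq_eqVlt => /orP[/eqP ->//|]; rewrite ltnS => jj' j'L.
apply: le_trans (IH jj' (ltnW j'L)) _; rewrite /urn_prob factS natrM exprSr.
have N0R : 0 < N%:R :> R by rewrite ltr0n.
have NN : N%:R ^+ j' != 0 :> R by rewrite expf_neq0// gt_eqF.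
have := urn_sum_add_ball uA j'L.
rewrite -(ler_pM2l (_ : 0 < j'`!%:R / (N%:R ^+ j' * N%:R) :> R)); last first.
  by rewrite divr_gt0 ?ltr0n ?fact_gt0// mulr_gt0// exprn_gt0.
congr (_ <= _); first by field; rewrite NN gt_eqF.
by rewrite mulrA; congr (_ * _); rewrite mulrAC (mulrC _ j'.+1%:R).
Qed.

Definition pois_prod L mu (k : {ffun 'I_N -> 'I_L.+1}) : R :=
  \prod_m poisson_pmf mu (k m).

Lemma pois_prod_ge0 L mu (k : {ffun 'I_N -> 'I_L.+1}) : 0 <= pois_prod mu k.
Proof. by apply: prodr_ge0 => m _; exact: poisson_pmf_ge0. Qed.

(** Independent Poisson counts with a given total are multinomial. *)
Lemma pois_prod_slice L mu j A : 0 < mu ->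
  \sum_(k : {ffun 'I_N -> 'I_L.+1} | (\sum_m k m == j)%N && A (counts k)) pois_prod mu k
  = poisson_pmf (N%:R * mu) j * urn_prob L j A.
Proof.
move=> mu0; have N0R : 0 < N%:R :> R by rewrite ltr0n.
rewrite poisson_pmfE ?mulr_gt0// /urn_prob /urn_sum !mulr_sumr.
apply: eq_bigr => k /andP[/eqP kj _].
rewrite /pois_prod; under eq_bigr do rewrite poisson_pmfE//.
rewrite !big_split/= prodrXr kj prodr_const card_ord -expRM_natl mulrN.
rewrite exprMn -/(urn_weight k); field.
by rewrite expf_neq0 ?gt_eqF// ltr0n fact_gt0.
Qed.

(** Each component of the mixture with at least n balls gives an increasing
    event at least the probability it has with n balls. *)
Lemma mixture_upper L n mu A : 0 < mu -> upclosed A -> (n <= L)%N ->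
  multinomial_prob n (fun _ => N%:R^-1 : R) A
    * \sum_(n <= j < L.+1) poisson_pmf (N%:R * mu) j
  <= \sum_(k : {ffun 'I_N -> 'I_L.+1} | A (counts k)) pois_prod mu k.
Proof.
move=> mu0 uA nL; rewrite urn_probE// mulr_sumr.
apply: (@le_trans _ _ (\sum_(n <= j < L.+1)
  \sum_(k : {ffun 'I_N -> 'I_L.+1} | (\sum_m k m == j)%N && A (counts k)) pois_prod mu k)).
  rewrite big_nat_cond [leRHS]big_nat_cond; apply: ler_sum => j; rewrite andbT ltnS => /andP[nj jL].
  rewrite pois_prod_slice// mulrC ler_wpM2l ?poisson_pmf_ge0//.
  rewrite {1}/urn_prob -(urn_sum_cap uA nL) -/(urn_prob L n A).
  exact: urn_prob_mono.
under eq_bigr do rewrite big_mkcond.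
rewrite exchange_big/= [leRHS]big_mkcond; apply: ler_sum => k _.
case: ifP => Ak; last by rewrite big1// => j _; rewrite andbF.
under eq_bigr do rewrite andbT; rewrite -big_mkcond/=.
rewrite (eq_bigl (fun j => j == \sum_m k m)%N) => [|j]; last by rewrite eq_sym.
rewrite big_nat1_eq; case: ifP => // _; exact: pois_prod_ge0.
Qed.

(** Each component with at most n balls gives the event at most the probability
    it has with n balls. *)
Lemma mixture_lower L n mu A : 0 < mu -> upclosed A -> (n <= L)%N ->
  \sum_(k : {ffun 'I_N -> 'I_L.+1} | A (counts k) && (\sum_m k m <= n)%N) pois_prod mu k
  <= multinomial_prob n (fun _ => N%:R^-1 : R) A.
Proof.
move=> mu0 uA nL; rewrite urn_probE//.
rewrite {1}/urn_prob -(urn_sum_cap uA nL) -/(urn_prob L n A).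
apply: (@le_trans _ _ (urn_prob L n A * \sum_(j < n.+1) poisson_pmf (N%:R * mu) j)); last first.
  by rewrite ler_piMr ?urn_prob_ge0// poisson_partial_le1// mulr_gt0// ltr0n.
apply: (@le_trans _ _ (\sum_(j < n.+1)
  \sum_(k : {ffun 'I_N -> 'I_L.+1} | (\sum_m k m == j)%N && A (counts k)) pois_prod mu k)).
  under [leRHS]eq_bigr do rewrite big_mkcond.
  rewrite exchange_big/= [leLHS]big_mkcond; apply: ler_sum => k _.
  case: ifP => [/andP[Ak kn]|_]; last first.
    by apply: sumr_ge0 => j _; case: ifP => // _; exact: pois_prod_ge0.
  rewrite (bigD1 (Ordinal (kn : (\sum_m k m < n.+1)%N)))//= eqxx Ak/= lerDl.
  by apply: sumr_ge0 => j _; case: ifP => // _; exact: pois_prod_ge0.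
rewrite mulr_sumr; apply: ler_sum => j _; rewrite pois_prod_slice// mulrC.
rewrite ler_wpM2r ?poisson_pmf_ge0//; apply: urn_prob_mono => //.
by rewrite -ltnS.
Qed.

Lemma sum_prod_ffun (T : finType) (phi : T -> R) :
  \sum_(k : {ffun 'I_N -> T}) \prod_m phi (k m) = (\sum_t phi t) ^+ N.
Proof.
by rewrite -(bigA_distr_bigA (fun _ t => phi t)) prodr_const card_ord.
Qed.

End Mixture.

(** * Poisson mass above the mean and far tails *)

Section PoissonMedian.
Context {R : realType}.

Lemma fact_reflect n j : (j < n)%N -> ((n + j)`! <= n ^ (j.*2).+1 * (n - j.+1)`!)%N.
Proof.
elim: j => [|j IH] jn.
  by rewrite addn0 expn1 subn1 -[in leqLHS](prednK jn) factS prednK.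
rewrite [in leqLHS]addnS factS doubleS.
apply: leq_trans (leq_mul (leqnn (n + j).+1) (IH (ltnW jn))) _.
have -> : ((n - j.+1)`! = (n - j.+1) * (n - j.+2)`!)%N.
  have -> : (n - j.+1 = (n - j.+2).+1)%N by rewrite -subSn// subSS.
  by rewrite factS.
have -> : (n ^ (j.*2).+3 = n * n * n ^ (j.*2).+1)%N.
  by rewrite (expnS n _.+2) (expnS n _.+1) mulnA.
set X := (n ^ _)%N; set Y := (_ `!)%N.
rewrite (_ : (_ * (X * _) = ((n + j).+1 * (n - j.+1)) * (X * Y))%N); last by ring.
rewrite -[leqRHS]mulnA leq_mul//.
by rewrite -addnS mulnC -subn_sqr mulnn leq_subr.
Qed.

Lemma poisson_pmf_reflect n j : (j < n)%N ->
  poisson_pmf (n%:R : R) (n - j.+1) <= poisson_pmf n%:R (n + j).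
Proof.
move=> jn; have n0 : 0 < n%:R :> R by rewrite ltr0n (leq_ltn_trans _ jn).
rewrite !poisson_pmfE// ler_wpM2r ?expR_ge0//.
rewrite ler_pdivrMr ?ltr0n ?fact_gt0// mulrAC ler_pdivlMr ?ltr0n ?fact_gt0//.
rewrite -!natrX -!natrM ler_nat.
apply: leq_trans (leq_mul (leqnn _) (fact_reflect jn)) _.
rewrite mulnA -expnD leq_mul//.
by rewrite (_ : n - j.+1 + (j.*2).+1 = n + j)%N// -addnn; lia.
Qed.

(** An atom of Poisson(n) below the mean is dominated by its mirror image:
    P(n - 1 - j) <= P(n + j).  So at least half of the mass lies at n or above, and
    a quarter up to a suitable finite L. *)
Lemma poisson_upper_half (n : nat) : (0 < n)%N ->
  exists2 L, (n <= L)%N & 4^-1 <= \sum_(n <= j < L.+1) poisson_pmf (n%:R : R) j.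
Proof.
move=> n0; have n0R : 0 < n%:R :> R by rewrite ltr0n.
have := poisson_E_lim n0R (tame_cst 1); rewrite poisson_E_cst => c1.
have : \forall M \near \oo, 2^-1 < series (fun k => poisson_pmf (n%:R : R) k * 1) M.
  by move/cvgrPdist_lt : c1 => /(_ 2^-1 ltac:(by rewrite invr_gt0)); apply: filterS => M;
     rewrite ltr_norml => /andP[_]; lra.
move=> [M0 _ hM].
pose L := (maxn M0 n.*2).
have nL : (n <= L)%N by rewrite /L leq_max -addnn leq_addr orbT.
exists L => //.
have : 2^-1 < series (fun k => poisson_pmf (n%:R : R) k * 1) L.+1.
  by apply: hM; rewrite /= /L leqW// leq_maxl.
rewrite /series/=; under eq_bigr do rewrite mulr1.
rewrite (@big_cat_nat _ _ _ n)//=; last exact: leqW.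
have : \sum_(0 <= j < n) poisson_pmf (n%:R : R) j <= \sum_(n <= j < L.+1) poisson_pmf (n%:R : R) j.
  apply: (@le_trans _ _ (\sum_(n <= j < n.*2) poisson_pmf (n%:R : R) j)).
    rewrite -{3}(add0n n) -addnn big_addn addnK big_nat_rev/= add0n.
    rewrite big_nat [leRHS]big_nat; apply: ler_sum => j /andP[_ jn].
    by rewrite (addnC j); exact: poisson_pmf_reflect.
  rewrite [leRHS](@big_cat_nat _ _ _ n.*2)//=; last 2 first.
  - by rewrite -addnn leq_addr.
  - by rewrite ltnW// ltnS /L leq_maxr.
  by rewrite lerDl; apply: sumr_ge0 => k _; exact: poisson_pmf_ge0.
lra.
Qed.

Lemma poisson_tail_exp (mu : R) K L : 0 < mu -> mu <= expR (-1) ->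
  \sum_(k < L | (K < k)%N) poisson_pmf mu k <= expR (- K%:R).
Proof.
move=> mu0 mu1.
apply: (@le_trans _ _ (\sum_(k < L) expR (- (K.+1)%:R) * exp_coeff 1 k)).
  rewrite big_mkcond; apply: ler_sum => k _; case: ifP => [Kk|_]; last first.
    by rewrite mulr_ge0 ?expR_ge0// exp_coeff_ge0.
  rewrite poisson_pmfE// /exp_coeff/= expr1n mul1r.
  apply: (@le_trans _ _ (mu ^+ k / k`!%:R)).
    by rewrite ler_piMr ?divr_ge0 ?exprn_ge0 ?(ltW mu0)// expR_le1 oppr_le0 ltW.
  rewrite ler_wpM2r// -mulrN1 expRM_natl.
  apply: (@le_trans _ _ (expR (-1) ^+ k)); first by rewrite lerXn2r ?nnegrE ?expR_ge0// ltW.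
  by rewrite ler_wiXn2l ?expR_ge0// expR_le1 oppr_le0.
rewrite -mulr_sumr.
have : \sum_(k < L) exp_coeff 1 k <= expR 1 :> R.
  rewrite -(big_mkord xpredT (exp_coeff (1 : R))).
  apply: (nondecreasing_cvgn_le _ (is_cvg_series_exp_coeff 1)).
  by apply/nondecreasing_seqP => k; rewrite seriesSr lerDl exp_coeff_ge0.
move=> /(ler_wpM2l (expR_ge0 (- (K.+1)%:R))) /le_trans; apply.
by rewrite -expRD -natr1 opprD addrNK.
Qed.

End PoissonMedian.

(** * Upper bound for the tail probability *)

Section UpperBound.
Context {R : realType}.
Context (f : nat -> R).

(** f(0) = f(1) = 0 and f(2) > 0 say that the statistic starts with collisions
    of two balls; monotonicity makes the rejection event increasing. *)
Record collision_kernel : Prop := CollisionKernel {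
  ck_tame : tame f;
  ck0 : f 0%N = 0;
  ck1 : f 1%N = 0;
  ck2 : 0 < f 2%N;
  ck_mono : forall k, f k <= f k.+1 }.

Context (fP : collision_kernel).

Let f2_gt0 : 0 < f 2%N := ck2 fP.

Lemma ck_le i j : (i <= j)%N -> f i <= f j.
Proof. by move=> ij; apply: (iffLR (nondecreasing_seqP f)) ij; exact: ck_mono. Qed.

Lemma ck_ge0 k : 0 <= f k.
Proof. by rewrite -(ck0 fP) ck_le. Qed.

Definition exceeds N (T : R) : pred ('I_N -> nat) := fun eta => T < \sum_m f (eta m).

Lemma exceeds_upclosed N T : upclosed (@exceeds N T).
Proof.
move=> k k' kk' /lt_le_trans; apply; apply: ler_sum => m _; exact: ck_le.
Qed.

(** Without truncation exp (t f) has infinite Poisson mean as soon as f grows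
    faster than k ln k. *)
Definition capped K k := if (k <= K)%N then f k else 0.

(** Either some cell holds more than K balls, which a union bound covers, or f
    agrees with its truncation and Markov's inequality applies to the
    exponential of the sum. *)
Lemma trunc_chernoff N L K (mu t T : R) : 0 < mu -> mu <= expR (-1) -> 0 <= t ->
  \sum_(k : {ffun 'I_N -> 'I_L.+1} | exceeds T (counts k)) pois_prod mu k <=
  N%:R * expR (- K%:R)
  + expR (- (t * T)) * (\sum_(k < L.+1) poisson_pmf mu k * expR (t * capped K k)) ^+ N.
Proof.
move=> mu0 mu1 t0.
apply: (@le_trans _ _ (\sum_(k : {ffun 'I_N -> 'I_L.+1}) pois_prod mu k *
  (\sum_m (K < k m)%:R + expR (- (t * T)) * \prod_m expR (t * capped K (k m))))).
  rewrite big_mkcond; apply: ler_sum => k _.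
  have p0 : 0 <= \prod_m expR (t * capped K (k m)) by apply: prodr_ge0 => m _; exact: expR_ge0.
  case: ifP => [ex|_]; last first.
    by rewrite mulr_ge0 ?pois_prod_ge0// addr_ge0 ?mulr_ge0 ?expR_ge0// sumr_ge0.
  rewrite ler_peMr ?pois_prod_ge0//.
  have [/existsP[m Km]|/existsPn noK] := boolP [exists m, (K < k m)%N].
    rewrite (bigD1 m)//= Km -addrA lerDl addr_ge0 ?mulr_ge0 ?expR_ge0//.
    by rewrite sumr_ge0.
  apply: (@le_trans _ _ (expR (- (t * T)) * \prod_m expR (t * capped K (k m)))).
    rewrite -expR_sum -expRD -expR0 ler_expR -mulr_sumr addrC -mulrBr mulr_ge0// subr_ge0.
    rewrite (eq_bigr (fun m => f (counts k m))) ?(ltW ex)// => m _.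
    by rewrite /capped leqNgt (negbTE (noK m)).
  by rewrite lerDr sumr_ge0.
under eq_bigr do rewrite mulrDr.
rewrite big_split/=; apply: lerD.
  under eq_bigr do rewrite mulr_sumr.
  rewrite exchange_big/=.
  apply: (@le_trans _ _ (\sum_(m < N) expR (- K%:R))); last first.
    by rewrite sumr_const card_ord mulr_natl.
  apply: ler_sum => m _.
  pose phi (i : 'I_N) (j : 'I_L.+1) := poisson_pmf mu j * (if i == m then (K < j)%:R else 1).
  rewrite (eq_bigr (fun k : {ffun 'I_N -> 'I_L.+1} => \prod_i phi i (k i))); last first.
    move=> k _; rewrite /phi big_split/= /pois_prod; congr (_ * _).
    rewrite (bigD1 m)//= eqxx big1 ?mulr1// => i /negbTE ->.
    by [].
  rewrite -bigA_distr_bigA (bigD1 m)//=.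
  apply: (@le_trans _ _ ((\sum_j phi m j) * 1)).
    rewrite ler_wpM2l//.
      by rewrite sumr_ge0// => j _; rewrite mulr_ge0 ?poisson_pmf_ge0//; case: ifP.
    apply: prodr_ile1 => i im; rewrite /phi (negbTE im).
    under eq_bigr do rewrite mulr1.
    by rewrite poisson_partial_le1// andbT sumr_ge0// => j _; exact: poisson_pmf_ge0.
  rewrite mulr1 /phi eqxx; apply: le_trans (poisson_tail_exp K L.+1 mu0 mu1).
  rewrite [leRHS]big_mkcond; apply: ler_sum => j _.
  by case: ifP => _; rewrite ?mulr1 ?mulr0.
rewrite -(sum_prod_ffun (fun j : 'I_L.+1 => poisson_pmf mu j * expR (t * capped K j))) mulr_sumr.
by apply: ler_sum => k _; rewrite big_split/= mulrCA.
Qed.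

(** Only the value at 2 needs a sharp expansion.  For k >= 3 the condition
    t f(k) <= k bounds the exponential by exp k, and these counts have
    probability O(mu^3). *)
Lemma trunc_mgf : exists2 C, 0 <= C & forall (mu t : R) K L,
  0 < mu -> mu <= 1 -> 0 <= t -> t * f 2%N <= 1 ->
  (forall k, (k <= K)%N -> t * f k <= k%:R) ->
  \sum_(k < L.+1) poisson_pmf mu k * expR (t * capped K k) <=
  expR (t * poisson_E mu f
    + mu ^+ 2 / 2 * ((t * f 2%N) ^+ 2 / 2 + expR 2 * (t * f 2%N) ^+ 3) + C * t ^+ 2 * mu ^+ 3).
Proof.
pose G k := f k ^+ 2 * expR 1 ^+ k.
have tf := ck_tame fP.
have tG : tame G by apply: tame_mul; [exact: tame_mul|exact: tame_exp].
have [a a1 aG] := tG; have a0 : 0 <= a by exact: le_trans a1.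
exists (a * expR a); first by rewrite mulr_ge0 ?expR_ge0.
move=> mu t K L mu0 mu1 t0 tf2 tK.
set u := t * f 2%N in tf2 *; set B := u ^+ 2 / 2 + expR 2 * u ^+ 3.
have u0 : 0 <= u by rewrite mulr_ge0// ltW.
have B0 : 0 <= B.
  apply: addr_ge0; first exact: divr_ge0 (sqr_ge0 _) _.
  by apply: mulr_ge0; [exact: expR_ge0|exact: exprn_ge0].
have ind : tame (fun k => (k == 2)%N%:R : R).
  apply: (tame_le (tame_cst 1)) => k; rewrite normr1 normr_nat lern1.
  by case: (_ == _).
(* H dominates the truncated exponential and has an explicit mean. *)
pose H k := (1 + t * f k) + (B * (k == 2)%N%:R + t ^+ 2 * tail3 G k).
have tT := tame_tail3 tG.
have t1 : tame (fun k => 1 + t * f k).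
  by apply: tame_add; [exact: tame_cst|exact: tame_scale].
have t2 : tame (fun k => B * (k == 2)%N%:R + t ^+ 2 * tail3 G k).
  by apply: tame_add; apply: tame_scale.
have tH : tame H by exact: tame_add.
have HE k : expR (t * capped K k) <= H k.
  have H1 : 1 <= H k.
    rewrite /H -addrA lerDl !addr_ge0 ?mulr_ge0 ?ck_ge0 ?exprn_ge0// /tail3.
    by case: ifP => // _; rewrite mulr_ge0 ?exprn_ge0 ?expR_ge0 ?ck_ge0.
  rewrite /capped; case: ifP => [kK|_]; last by rewrite mulr0 expR0.
  move: k kK H1 => [|[|[|k]]] kK.
  - by rewrite (ck0 fP) mulr0 expR0.
  - by rewrite (ck1 fP) mulr0 expR0.
  - move=> _; rewrite -/u /H /tail3/= -/u mulr0 addr0 mulr1 /B !addrA.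
    exact: expR_le_cubic.
  move=> _; rewrite /H /tail3/= mulr0 add0r.
  set x := t * f k.+3.
  have x0 : 0 <= x by rewrite mulr_ge0 ?ck_ge0.
  apply: le_trans (expR_le_exp_mul x0) _; rewrite lerD2l /G /x exprMn -mulrA.
  rewrite ler_wpM2l ?sqr_ge0// ler_wpM2l ?sqr_ge0//.
  by rewrite -expRM_natl mulr1 ler_expR tK.
apply: (@le_trans _ _ (poisson_E mu H)).
  have H0 k : 0 <= H k by apply: le_trans (HE k); exact: expR_ge0.
  apply: le_trans (poisson_partial_le L.+1 mu0 tH H0).
  by apply: ler_sum => k _; rewrite ler_wpM2l ?poisson_pmf_ge0.
rewrite /H poisson_E_add// poisson_E_lin// poisson_E_pmf// poisson_E_add//; last 2 first.
  exact: tame_cst.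
  exact: tame_scale.
rewrite poisson_E_cst poisson_E_scale//.
have := poisson_E_tail3 mu0 mu1 aG => /ler_normlW hT.
have hT2 : t ^+ 2 * poisson_E mu (tail3 G) <= a * expR a * t ^+ 2 * mu ^+ 3.
  by rewrite [leRHS](_ : _ = t ^+ 2 * (a * expR a * mu ^+ 3)); [rewrite ler_wpM2l ?sqr_ge0|ring].
have p2 : poisson_pmf mu 2 <= mu ^+ 2 / 2.
  rewrite poisson_pmfE// ler_piMr ?expR_le1 ?oppr_le0 ?(ltW mu0)//.
  by rewrite divr_ge0 ?sqr_ge0.
have p2B : B * poisson_pmf mu 2 <= mu ^+ 2 / 2 * B by rewrite mulrC ler_wpM2r.
apply: le_trans (expR_ge1Dx _); rewrite -!addrA lerD2l lerD2l.
exact: lerD.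
Qed.

(** Since the eps_m add up to 0, the first-order terms cancel. *)
Lemma threshold_expansion : exists2 C, 0 <= C & forall N (eps : 'I_N -> R) (lam e : R),
  0 < lam -> lam <= 1 -> (forall m, `|eps m| <= 2^-1) -> \sum_m eps m = 0 ->
  N%:R * e = \sum_m eps m ^+ 2 ->
  `|\sum_m poisson_E (lam * (1 + eps m)) f - N%:R * poisson_E lam f
     - f 2%N / 2 * lam ^+ 2 * (N%:R * e)| <= C * lam ^+ 3 * (N%:R * e).
Proof.
have [C C0 hC] := poisson_mean_shift (ck_tame fP) (ck0 fP) (ck1 fP).
exists C => // N eps lam e l0 l1 heps s0 he.
have [c _ hc] := hC lam l0 l1.
rewrite (_ : _ - _ = \sum_m (poisson_E (lam * (1 + eps m)) f - poisson_E lam f - c * eps m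
       - f 2%N / 2 * lam ^+ 2 * eps m ^+ 2)); last first.
  rewrite !sumrB -!mulr_sumr s0 mulr0 subr0 he sumr_const card_ord.
  by rewrite mulr_natl.
apply: le_trans (ler_norm_sum _ _ _) _; rewrite he mulr_sumr.
by apply: ler_sum => m _; exact: hc.
Qed.

(** With t = e / f(2), the minimizer of the leading exponent
    N lam^2 (t^2 f(2)^2 / 4 - t f(2) e / 2), whose minimum is - n lam e^2 / 4. *)
Lemma upper_bound : exists2 C, 0 <= C &
  forall N n (eps : 'I_N -> R) (lam e : R) K,
  (0 < N)%N -> (0 < n)%N -> lam = n%:R / N%:R -> lam <= expR (-1) ->
  (forall m, `|eps m| <= 2^-1) -> \sum_m eps m = 0 ->
  N%:R * e = \sum_m eps m ^+ 2 -> 0 < e -> e <= 1 ->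
  (forall k, (k <= K)%N -> e * f k <= f 2%N * k%:R) ->
  n%:R * lam * e ^+ 2 + ln N%:R <= K%:R ->
  multinomial_prob n (fun _ : 'I_N => N%:R^-1)
     (exceeds (\sum_m poisson_E (lam * (1 + eps m)) f))
  <= 8 * expR (- (n%:R * lam * e ^+ 2 * (4^-1 - C * (lam + e)))).
Proof.
have [C1 C10 hC1] := threshold_expansion.
have [C2 C20 hC2] := trunc_mgf.
(* The errors of the threshold and of the mgf, rescaled by t = e / f(2). *)
pose C := C1 / f 2%N + C2 / f 2%N ^+ 2 + expR 2.
have f20 : f 2%N != 0 by rewrite gt_eqF.
have CC1 : 0 <= C1 / f 2%N by rewrite divr_ge0// ltW.
have CC2 : 0 <= C2 / f 2%N ^+ 2 by rewrite divr_ge0// sqr_ge0.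
have C0 : 0 <= C by rewrite /C !addr_ge0 ?expR_ge0.
exists C => // N n eps lam e K N0 n0 lamE laml heps s0 he e0 e1 hK hv.
have N0R : 0 < N%:R :> R by rewrite ltr0n.
have n0R : 0 < n%:R :> R by rewrite ltr0n.
have l0 : 0 < lam by rewrite lamE divr_gt0.
have l1 : lam <= 1 by apply: le_trans laml _; rewrite expR_le1 oppr_le0.
set T := \sum_m _.
set v := n%:R * lam * e ^+ 2 in hv *.
have v0 : 0 < v by rewrite /v !mulr_gt0// exprn_gt0.
have vE : v = N%:R * lam ^+ 2 * e ^+ 2.
  by rewrite /v lamE; field; rewrite gt_eqF.
pose t := e / f 2%N.
have t0 : 0 <= t by rewrite divr_ge0 ?ltW.
have tf2 : t * f 2%N = e by rewrite /t mulfVK.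
have hKt k : (k <= K)%N -> t * f k <= k%:R.
  by move=> kK; rewrite /t mulrAC ler_pdivrMr// (mulrC k%:R); exact: hK.
have [L nL hL] := @poisson_upper_half R n n0.
have := mixture_upper N0 l0 (exceeds_upclosed (T := T)) nL.
have -> : N%:R * lam = n%:R by rewrite lamE mulrC divfK// gt_eqF.
set P := multinomial_prob _ _ _ => hP.
have P0 : 0 <= P by rewrite /P urn_probE ?urn_prob_ge0//; exact: exceeds_upclosed.
have h4 : P * 4^-1 <= \sum_(k : {ffun 'I_N -> 'I_L.+1} | exceeds T (counts k)) pois_prod lam k.
  by apply: le_trans hP; rewrite ler_wpM2l.
have := le_trans h4 (trunc_chernoff N L K T l0 laml t0).
have mg := hC2 lam t K L l0 l1 t0 (ltac:(by rewrite tf2)) hKt.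
rewrite tf2 in mg.
have S0 : 0 <= \sum_(k < L.+1) poisson_pmf lam k * expR (t * capped K k).
  by apply: sumr_ge0 => j _; rewrite mulr_ge0 ?poisson_pmf_ge0 ?expR_ge0.
have mgN := lerXn2r N (S0 : _ \is Num.nneg) (expR_ge0 _ : _ \is Num.nneg) mg.
rewrite -expRM_natl in mgN.
have hT := hC1 N eps lam e l0 l1 heps s0 he.
rewrite -/T in hT.
have hTl : N%:R * poisson_E lam f + f 2%N / 2 * lam ^+ 2 * (N%:R * e)
    - C1 * lam ^+ 3 * (N%:R * e) <= T.
  by move: hT; rewrite ler_norml => /andP[]; lra.
have hTl2 := ler_wpM2l t0 hTl.
set E := 4^-1 - C * (lam + e).
have hexp : expR (- (t * T)) * (\sum_(k < L.+1) poisson_pmf lam k * expR (t * capped K k)) ^+ N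
    <= expR (- (v * E)).
  apply: le_trans (ler_wpM2l (expR_ge0 _) mgN) _.
  rewrite -expRD ler_expR vE.
  apply: (@le_trans _ _ (- (t * (N%:R * poisson_E lam f + f 2%N / 2 * lam ^+ 2 * (N%:R * e)
    - C1 * lam ^+ 3 * (N%:R * e))) +
     N%:R * (t * poisson_E lam f + lam ^+ 2 / 2 * (e ^+ 2 / 2 + expR 2 * e ^+ 3) +
             C2 * t ^+ 2 * lam ^+ 3))); first by rewrite lerD2r lerN2.
  rewrite (_ : _ + _ = - (N%:R * lam ^+ 2 * e ^+ 2 * (4^-1 - (C1 / f 2%N + C2 / f 2%N ^+ 2) * lam
    - expR 2 / 2 * e))); last by rewrite /t; field.
  rewrite lerN2 ler_wpM2l//; first by rewrite -vE ltW.
  rewrite /E /C; have := expR_gt0 (2 : R) => e20.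
  have := mulr_ge0 (addr_ge0 CC1 CC2) (ltW e0).
  have := mulr_gt0 e20 e0; have := mulr_gt0 e20 l0; lra.
have hE : N%:R * expR (- K%:R) <= expR (- (v * E)).
  rewrite -{1}(lnK (N0R : _ \is Num.pos)) -expRD ler_expR.
  have : v * E <= v * 1.
    rewrite ler_wpM2l ?(ltW v0)// /E.
    have := mulr_ge0 C0 (addr_ge0 (ltW l0) (ltW e0)); lra.
  lra.
lra.
Qed.

End UpperBound.

(** * Chebyshev's inequality for product laws *)

Section Chebyshev.
Context {R : realType} {N : nat} {T : finType}.
Context (b : T -> R).
Context (b0 : forall t, 0 <= b t).
Context (b1 : \sum_t b t = 1).

Lemma product_second_moment (psi : T -> R) : \sum_t b t * psi t = 0 ->
  \sum_(k : {ffun 'I_N -> T}) (\prod_m b (k m)) * (\sum_m psi (k m)) ^+ 2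
  = N%:R * \sum_t b t * psi t ^+ 2.
Proof.
move=> psi0.
pose phi (m m' i : 'I_N) t :=
  b t * ((if i == m then psi t else 1) * (if i == m' then psi t else 1)).
transitivity (\sum_(m < N) \sum_(m' < N) \prod_i \sum_t phi m m' i t).
  under [RHS]eq_bigr do under eq_bigr do rewrite bigA_distr_bigA/=.
  under [RHS]eq_bigr do rewrite exchange_big/=.
  rewrite exchange_big/=; apply: eq_bigr => k _.
  rewrite expr2 mulr_suml mulr_sumr; apply: eq_bigr => m _.
  rewrite !mulr_sumr; apply: eq_bigr => m' _.
  rewrite /phi !big_split/=; congr (_ * (_ * _)).
    by rewrite (bigD1 m)//= eqxx big1 ?mulr1// => i /negbTE ->.
  by rewrite (bigD1 m')//= eqxx big1 ?mulr1// => i /negbTE ->.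
rewrite (eq_bigr (fun=> \sum_t b t * psi t ^+ 2)) => [|m _].
  by rewrite sumr_const card_ord mulr_natl.
rewrite (bigD1 m)//= [X in _ + X]big1 ?addr0 => [|m' mm']; last first.
  rewrite (bigD1 m)//= [X in X * _](_ : _ = 0) ?mul0r//; transitivity (\sum_t b t * psi t) => //.
  by apply: eq_bigr => t _; rewrite /phi eqxx eq_sym (negbTE mm') mulr1.
rewrite (bigD1 m)//= [X in _ * X]big1 ?mulr1 => [|i im].
  by apply: eq_bigr => t _; rewrite /phi eqxx expr2.
by rewrite -[RHS]b1; apply: eq_bigr => t _; rewrite /phi (negbTE im) !mulr1.
Qed.

(** With the constant 6, three such events leave mass 1/2 to the intersection
    of their complements. *)
Lemma product_chebyshev (psi : T -> R) (D : R) (Q : pred {ffun 'I_N -> T}) : 0 < D ->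
  N%:R * (\sum_t b t * psi t ^+ 2) <= D ^+ 2 / 6 ->
  (forall k, Q k -> D <= `|\sum_m psi (k m) - N%:R * \sum_t b t * psi t|) ->
  \sum_(k : {ffun 'I_N -> T} | Q k) \prod_m b (k m) <= 6^-1.
Proof.
move=> D0 hV hQ; set a := \sum_t b t * psi t in hQ.
pose psi' t := psi t - a.
have psi'0 : \sum_t b t * psi' t = 0.
  rewrite /psi'; under eq_bigr do rewrite mulrBr.
  by rewrite sumrB -mulr_suml b1 mul1r subrr.
have h2 : \sum_t b t * psi' t ^+ 2 <= \sum_t b t * psi t ^+ 2.
  have -> : \sum_t b t * psi' t ^+ 2 = \sum_t b t * psi t ^+ 2 - a ^+ 2.
    transitivity (\sum_t (b t * psi t ^+ 2 - 2 * a * (b t * psi t) + a ^+ 2 * b t)).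
      by apply: eq_bigr => t _; rewrite /psi'; ring.
    by rewrite big_split sumrB/= -!mulr_sumr b1 -/a; ring.
  by rewrite lerBlDr lerDl sqr_ge0.
have D20 : 0 < D ^+ 2 by rewrite exprn_gt0.
rewrite -(ler_pM2r D20) mulr_suml.
apply: (@le_trans _ _ (N%:R * \sum_t b t * psi' t ^+ 2)); last first.
  by apply: le_trans (ler_wpM2l (ler0n R N) h2) _; rewrite (mulrC 6^-1).
rewrite -product_second_moment// big_mkcond; apply: ler_sum => k _.
have p0 : 0 <= \prod_m b (k m) by apply: prodr_ge0.
case: ifP => [Qk|_]; last by rewrite mulr_ge0// sqr_ge0.
rewrite ler_wpM2l//.
have -> : \sum_m psi' (k m) = \sum_m psi (k m) - N%:R * a.
  by rewrite sumrB sumr_const card_ord mulr_natl.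
rewrite -[leRHS]real_normK ?num_real// lerXn2r ?nnegrE ?(ltW D0)//.
exact: hQ.
Qed.

End Chebyshev.

(** * Change of measure on pairs *)

Section TiltedLower.
Context {R : realType}.
Context (f : nat -> R).
Context (fP : collision_kernel f).

Definition is_pair (k : nat) : R := (k == 2)%N%:R.

(** Favouring pairs alone achieves the leading order of the cost, and unlike
    exp (t f) it has a finite mean whatever the growth of f. *)
Definition tilted (mu th : R) L (k : 'I_L.+1) := poisson_pmf mu k * expR (th * is_pair k).

(** Where the statistic exceeds T, the total is at most n and there are at most x
    pairs, the density of the Poisson law with respect to the tilted one is at
    least Z^N exp (- th x).  Chebyshev's inequality for the sum of f, the total
    and the number of pairs shows that this happens with tilted probability at
    least 1/2.  The margins D1, D2 and D3 must beat the standard deviations. *)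
Lemma tilted_lower N n L (mu th T x D1 D2 D3 : R)
   (Z := \sum_k @tilted mu th L k) (b := fun k => @tilted mu th L k / Z) :
  (0 < N)%N -> (n <= L)%N -> 0 < mu -> 0 <= th -> 0 < D1 -> 0 < D2 -> 0 < D3 ->
  T + D1 <= N%:R * \sum_k b k * f k -> N%:R * (\sum_k b k * f k ^+ 2) <= D1 ^+ 2 / 6 ->
  N%:R * (\sum_k b k * k%:R) + D2 <= n%:R -> N%:R * (\sum_k b k * k%:R ^+ 2) <= D2 ^+ 2 / 6 ->
  N%:R * (\sum_k b k * is_pair k) + D3 <= x -> N%:R * (\sum_k b k * is_pair k) <= D3 ^+ 2 / 6 ->
  2^-1 * (Z ^+ N * expR (- (th * x))) <=
  multinomial_prob n (fun _ : 'I_N => N%:R^-1) (exceeds f T).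
Proof.
move=> N0 nL mu0 th0 D10 D20 D30 h1 v1 h2 v2 h3 v3.
have a0 k : 0 < @tilted mu th L k by rewrite mulr_gt0 ?expR_gt0 ?poisson_pmf_gt0.
have Z0 : 0 < Z.
  by rewrite /Z (bigD1 ord0)//= ltr_pwDl// sumr_ge0// => k _; exact: ltW.
have b0 k : 0 <= b k by rewrite divr_ge0 ?ltW.
have b1 : \sum_k b k = 1 by rewrite -mulr_suml divff// gt_eqF.
apply: le_trans (mixture_lower N0 mu0 (exceeds_upclosed fP (T := T)) nL).
pose X2 (k : {ffun 'I_N -> 'I_L.+1}) := \sum_m is_pair (k m).
pose W (k : {ffun 'I_N -> 'I_L.+1}) := \prod_m b (k m).
have W0 k : 0 <= W k by apply: prodr_ge0.
pose Q1 (k : {ffun 'I_N -> 'I_L.+1}) := ~~ exceeds f T (counts k).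
pose Q2 (k : {ffun 'I_N -> 'I_L.+1}) := (n < \sum_m k m)%N.
pose Q3 (k : {ffun 'I_N -> 'I_L.+1}) := x < X2 k.
have c1 : \sum_(k | Q1 k) W k <= 6^-1.
  apply: (@product_chebyshev _ _ _ _ b0 b1 (fun k => f k) D1) => // k.
  rewrite /Q1 /exceeds -leNgt => hk; rewrite distrC.
  apply: le_trans (ler_norm _); move: hk; rewrite /counts; lra.
have c2 : \sum_(k | Q2 k) W k <= 6^-1.
  apply: (@product_chebyshev _ _ _ _ b0 b1 (fun k => k%:R) D2) => // k.
  rewrite /Q2 -(ltr_nat R) natr_sum => hk.
  apply: le_trans (ler_norm _); lra.
have c3 : \sum_(k | Q3 k) W k <= 6^-1.
  apply: (@product_chebyshev _ _ _ _ b0 b1 (fun k => is_pair k) D3) => //.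
    rewrite (eq_bigr (fun k => b k * is_pair k)) ?v3// => k _.
    by rewrite /is_pair; case: (_ == _); rewrite ?expr1n// expr0n.
  move=> k; rewrite /Q3 /X2 => hk; apply: le_trans (ler_norm _); lra.
pose good k := [&& exceeds f T (counts k), (\sum_m k m <= n)%N & X2 k <= x].
have hg : 2^-1 <= \sum_(k | good k) W k.
  have tot : \sum_k W k = 1.
    by rewrite /W sum_prod_ffun b1 expr1n.
  have : \sum_k W k <= \sum_(k | good k) W k + (\sum_(k | Q1 k) W k + \sum_(k | Q2 k) W k + \sum_(k | Q3 k) W k).
    rewrite [X in _ <= X + _]big_mkcond [X in _ <= _ + (X + _ + _)]big_mkcond.
    rewrite [X in _ <= _ + (_ + X + _)]big_mkcond [X in _ <= _ + (_ + _ + X)]big_mkcond.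
    rewrite -!big_split/=; apply: ler_sum => k _.
    have := W0 k; rewrite /good /Q1 /Q2 /Q3 (leqNgt (\sum_m k m)%N n) (leNgt (X2 k)).
    by case: (exceeds _ _ _); case: (n < _)%N; case: (x < _); clear -W0 => /=; lra.
  by rewrite tot; lra.
apply: (@le_trans _ _ (\sum_(k | good k) (Z ^+ N * expR (- (th * x))) * W k)).
  have ZE : 0 <= Z ^+ N * expR (- (th * x)) by rewrite mulr_ge0 ?expR_ge0// exprn_ge0// ltW.
  by rewrite -mulr_sumr mulrC ler_wpM2l.
rewrite big_mkcond [leRHS]big_mkcond; apply: ler_sum => k _.
rewrite /good; case: (exceeds _ _ _); case: (\sum_m k m <= n)%N => //=.
case: ifP => [Xx|_]; last exact: pois_prod_ge0.
have -> : pois_prod mu k = Z ^+ N * expR (- (th * X2 k)) * W k.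
  rewrite /W /b big_split/= prodr_const card_ord exprVn /tilted big_split/=.
  rewrite -expR_sum -mulr_sumr -/(X2 k) -/(pois_prod mu k) expRN.
  by field; rewrite expf_neq0 ?gt_eqF// expR_gt0.
rewrite ler_wpM2r// ler_wpM2l ?exprn_ge0 ?(ltW Z0)//.
by rewrite ler_expR lerN2 ler_wpM2l.
Qed.

End TiltedLower.

(** * Lower bound for the tail probability *)

Section LowerBound.
Context {R : realType}.
Context (f : nat -> R).
Context (fP : collision_kernel f).

Let f2_gt0 : 0 < f 2%N := ck2 fP.

Lemma tilted_sum (mu th : R) L (g : nat -> R) : (2 <= L)%N ->
  \sum_k @tilted R mu th L k * g k =
  \sum_(k < L.+1) poisson_pmf mu k * g k + (expR th - 1) * poisson_pmf mu 2 * g 2%N.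
Proof.
move=> L2; have L2' : (2 < L.+1)%N by [].
rewrite (bigD1 (Ordinal L2'))//= [in RHS](bigD1 (Ordinal L2'))//=.
rewrite /tilted/= /is_pair eqxx mulr1.
rewrite (eq_bigr (fun k : 'I_L.+1 => poisson_pmf mu k * g k)); last first.
  move=> k k2; have -> : (k == 2 :> nat)%N = false.
    by apply/negbTE; apply: contraNneq k2 => k2; apply/eqP/val_inj.
  by rewrite mulr0 expR0 mulr1.
ring.
Qed.

Lemma partial_sums_near (mu eta : R) n : 0 < mu -> 0 < eta ->
  exists2 L, (n <= L)%N &
   1 - eta <= \sum_(k < L.+1) poisson_pmf mu k /\
   poisson_E mu f - eta <= \sum_(k < L.+1) poisson_pmf mu k * f k.
Proof.
move=> mu0 eta0.
have near F : tame F -> \forall M \near \oo,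
    poisson_E mu F - eta <= series (fun k => poisson_pmf mu k * F k) M.
  move=> tF; have /cvgrPdist_lt /(_ _ eta0) := poisson_E_lim mu0 tF.
  by apply: filterS => M; rewrite ltr_norml => /andP[_]; lra.
have [M1 _ h1] := near _ (tame_cst 1).
have [M2 _ h2] := near _ (ck_tame fP).
pose L := maxn n (maxn M1 M2).
exists L; first exact: leq_maxl.
split; last first.
  have := h2 L.+1; rewrite /= /series/= big_mkord; apply.
  by rewrite /L leqW// !leq_max leqnn !orbT.
have := h1 L.+1; rewrite /= /series/= big_mkord poisson_E_cst.
move=> h; apply: le_trans (h _) _; first by rewrite /L leqW// !leq_max leqnn !orbT.
by apply: ler_sum => k _; rewrite mulr1.
Qed.

Lemma tilted_sum_le (mu th : R) L (g : nat -> R) : 0 < mu -> (2 <= L)%N -> tame g ->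
  (forall k, 0 <= g k) ->
  \sum_k @tilted R mu th L k * g k <=
  poisson_E mu g + (expR th - 1) * poisson_pmf mu 2 * g 2%N.
Proof.
move=> mu0 L2 tg g0; rewrite tilted_sum// lerD2r.
exact: (poisson_partial_le L.+1).
Qed.

Lemma pair_prob_bounds (mu lam e : R) : 0 < mu -> mu <= lam -> lam <= 1 ->
  0 < e -> e <= 1 -> lam * (1 - e) <= mu ->
  lam ^+ 2 / 2 * (1 - 2 * e - lam) <= poisson_pmf mu 2 /\
  poisson_pmf mu 2 <= lam ^+ 2 / 2.
Proof.
move=> mu0 mul l1 e0 e1 mue.
have l0 : 0 < lam by exact: lt_le_trans mul.
have p2E : poisson_pmf mu 2 = mu ^+ 2 / 2 * expR (- mu) by rewrite poisson_pmfE.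
have mu2 : mu ^+ 2 <= lam ^+ 2 by rewrite lerXn2r ?nnegrE // ltW.
split; last first.
  apply: (@le_trans _ _ (mu ^+ 2 / 2)); last by rewrite ler_wpM2r.
  by rewrite p2E ler_piMr ?divr_ge0 ?sqr_ge0// expR_le1 oppr_le0 ltW.
apply: (@le_trans _ _ ((lam * (1 - e)) ^+ 2 / 2 * (1 - lam))).
  rewrite [leRHS](_ : _ = lam ^+ 2 / 2 * ((1 - e) ^+ 2 * (1 - lam))); last by ring.
  rewrite ler_wpM2l ?divr_ge0 ?sqr_ge0//.
  have : 0 <= e * lam * (2 - e) + e ^+ 2.
    by rewrite addr_ge0 ?sqr_ge0// mulr_ge0 ?mulr_ge0 ?(ltW e0) ?(ltW l0)//; lra.
  lra.
rewrite p2E; apply: ler_pM.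
- by rewrite divr_ge0 ?sqr_ge0.
- by rewrite subr_ge0.
- rewrite ler_wpM2r// lerXn2r ?nnegrE ?(ltW mu0)// mulr_ge0 ?(ltW l0)//.
  by rewrite subr_ge0.
- have := expR_ge1Dx (- mu); lra.
Qed.

(** The last bound gives the cost of the tilt: th^2 / 2 per expected pair, up to
    a factor 1 + th. *)
Lemma tilt_bounds (th : R) : 0 < th -> th <= 4^-1 ->
  [/\ th <= expR th - 1, expR th - 1 <= 2 * th &
      - (th ^+ 2 / 2 * (1 + th)) <= expR th - 1 - th * expR th].
Proof.
move=> th0 th4; split.
- by have := expR_ge1Dx th; lra.
- have th2 : `|th| <= 2^-1 by rewrite gtr0_norm//; lra.
  have := expR_le_quad th2; have : th ^+ 2 <= th * 4^-1 by rewrite expr2 ler_wpM2l// ltW.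
  lra.
- have t1 : 0 <= 1 - th by lra.
  have := ler_wpM2l t1 (expR_ge_quad (ltW th0)); lra.
Qed.

Lemma normalized_tilt_le (mu th : R) L (g : nat -> R) (Z := \sum_k @tilted R mu th L k) :
  0 < mu -> (2 <= L)%N -> 1 <= Z -> tame g -> (forall k, 0 <= g k) ->
  \sum_k @tilted R mu th L k / Z * g k <=
  poisson_E mu g + (expR th - 1) * poisson_pmf mu 2 * g 2%N.
Proof.
move=> mu0 L2 Z1 tg g0.
have -> : \sum_k @tilted R mu th L k / Z * g k = (\sum_k @tilted R mu th L k * g k) / Z.
  by rewrite mulr_suml; apply: eq_bigr => k _; rewrite mulrAC.
apply: le_trans (tilted_sum_le th mu0 L2 tg g0).
rewrite ler_pdivrMr ?(lt_le_trans _ Z1)// ler_peMr// sumr_ge0// => k _.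
by rewrite mulr_ge0// mulr_ge0 ?expR_ge0 ?poisson_pmf_ge0.
Qed.

(** To leading order th = e brings the mean of the statistic to the threshold.
    Taking th = (1 + B0 dl) e and the intensity lam (1 - dl e) leaves margins of
    relative size dl e for the statistic, the total and the number of pairs.
    They exceed the standard deviations as soon as n lam e^2 is large, and
    change the exponent by a relative error O(dl) only. *)
Lemma lower_bound : exists2 B, 1 <= B & forall dl, 0 < dl -> dl <= B^-1 ->
  exists2 c, 0 < c & forall N n (eps : 'I_N -> R) (lam e : R),
  (0 < N)%N -> (0 < n)%N -> lam = n%:R / N%:R -> lam <= c ->
  (forall m, `|eps m| <= 2^-1) -> \sum_m eps m = 0 ->
  N%:R * e = \sum_m eps m ^+ 2 -> 0 < e -> e <= c ->
  c^-1 <= n%:R * lam * e ^+ 2 ->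
  2^-1 * expR (- (n%:R * lam * e ^+ 2 * (4^-1 + B * dl))) <=
  multinomial_prob n (fun _ : 'I_N => N%:R^-1)
     (exceeds f (\sum_m poisson_E (lam * (1 + eps m)) f)).
Proof.
have [C1 C10 hC1] := threshold_expansion fP.
have [C2 C20 hC2] := poisson_mean_shift (ck_tame fP) (ck0 fP) (ck1 fP).
have [C3 C30 hC3] := poisson_E_order2 (ck_tame fP) (ck0 fP) (ck1 fP).
have tf2 : tame (fun k => f k ^+ 2) by apply: tame_mul; exact: ck_tame.
have [C4 C40 hC4] := poisson_E_order2 tf2 (ltac:(by rewrite /= (ck0 fP) expr0n))
   (ltac:(by rewrite /= (ck1 fP) expr0n)).
have f2p := f2_gt0.
set F := f 2%N in f2p hC1 hC2 hC3 hC4 *.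
pose C' := F / 2 + C3.
(* F B0 / 2 = 3 F + 2 C2 pays for the loss 2 C2 dl caused by the lower
   intensity, for the cap, for the margin D1 and for the small terms. *)
pose B0 := 6 + 4 * C2 / F.
have B06 : 6 <= B0 by rewrite /B0 lerDl divr_ge0 ?mulr_ge0// ltW.
pose CV := F ^+ 2 / 2 + C4 + 2 * F ^+ 2.
pose CM := C1 + 2 * (C' + 2 * F) + 3 * F.
have C'0 : 0 <= C' by rewrite addr_ge0// divr_ge0// ltW.
have CM0 : 0 < CM.
  have : 0 <= 2 * (C' + 2 * F) by rewrite mulr_ge0// addr_ge0// mulr_ge0// ltW.
  by rewrite /CM; lra.
have CV0 : 0 < CV.
  by rewrite /CV ltr_wpDl ?mulr_gt0 ?exprn_gt0// addr_ge0 ?divr_ge0 ?sqr_ge0.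
exists (3 * B0 + 5); first by lra.
move=> dl dl0 dlB.
have Bdl : B0 * dl <= 1 / 3.
  have : (3 * B0 + 5) * dl <= 1 by rewrite mulrC -ler_pdivlMr ?div1r//; lra.
  nra.
have dl1 : dl <= 1 / 18 by nra.
(* The first two bounds make lam and e small against dl; through
   c^-1 <= n lam e^2 the other two make the variances small against the margins. *)
pose c := Num.min (dl / 16) (Num.min (dl * F / (2 * CM))
  (Num.min (dl ^+ 2 * F ^+ 2 / (6 * CV)) (dl ^+ 2 / 240))).
have c0 : 0 < c.
  rewrite /c !lt_min; apply/and4P; split; apply: divr_gt0 => //; last exact: exprn_gt0.
  - exact: mulr_gt0.
  - exact: mulr_gt0.
  - by apply: mulr_gt0; exact: exprn_gt0.
  - exact: mulr_gt0.
exists c => // N n eps lam e N0 n0 lamE lamc heps s0 he e0 ec hv.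
have [cA [cB [cC cD]]] : c <= dl / 16 /\ c <= dl * F / (2 * CM) /\
   c <= dl ^+ 2 * F ^+ 2 / (6 * CV) /\ c <= dl ^+ 2 / 240.
  by rewrite /c !ge_min !lexx !orbT.
have N0R : 0 < N%:R :> R by rewrite ltr0n.
have n0R : 0 < n%:R :> R by rewrite ltr0n.
have l0 : 0 < lam by rewrite lamE divr_gt0.
set v := n%:R * lam * e ^+ 2 in hv *.
have v0 : 0 < v by rewrite /v !mulr_gt0// exprn_gt0.
have nE : n%:R = N%:R * lam by rewrite lamE mulrC divfK// gt_eqF.
have vE : v = N%:R * lam ^+ 2 * e ^+ 2 by rewrite /v nE; ring.
have l16 : lam <= dl / 16 by move: lamc cA; clear -f2_gt0; lra.
have e16 : e <= dl / 16 by move: ec cA; clear -f2_gt0; lra.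
set T := \sum_m _.
have l1 : lam <= 1 by move: l16 dl1; clear -f2_gt0; lra.
have e1 : e <= 1 by move: e16 dl1; clear -f2_gt0; lra.
have lsq : lam ^+ 2 <= dl / 16.
  by apply: le_trans l16; rewrite expr2 ler_piMl// ltW.
have hT : T <= N%:R * (poisson_E lam f + F / 2 * lam ^+ 2 * e + C1 * lam ^+ 3 * e).
  have := hC1 N eps lam e l0 l1 heps s0 he; rewrite -/T ler_norml => /andP[_]; clear -f2_gt0; lra.
pose th := (1 + B0 * dl) * e.
have Bd0 : 0 <= B0 * dl by rewrite mulr_ge0// ltW//; move: B06; clear -f2_gt0; lra.
have th0 : 0 < th by rewrite /th mulr_gt0//; move: Bd0; clear -f2_gt0; lra.
have the : e <= th by rewrite /th ler_peMl ?(ltW e0)//; move: Bd0; clear -f2_gt0; lra.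
have th2 : th <= 2 * e by rewrite /th ler_wpM2r ?(ltW e0)//; move: Bdl; clear -f2_gt0; lra.
have thq : th <= 4^-1 by move: th2 e16 dl1; clear -f2_gt0; lra.
pose mu := lam * (1 + - (dl * e)).
have de0 : 0 < dl * e by rewrite mulr_gt0.
have de1 : dl * e <= e by rewrite ler_piMl ?(ltW e0)//; move: dl1; clear -f2_gt0; lra.
have mu0 : 0 < mu by rewrite /mu mulr_gt0//; move: de1 e16 dl1; clear -f2_gt0; lra.
have mul : mu <= lam by rewrite /mu ler_piMr ?(ltW l0)//; move: de0; clear -f2_gt0; lra.
have mu1 : mu <= 1 by exact: le_trans mul l1.
have mue : lam * (1 - e) <= mu by rewrite /mu ler_wpM2l ?(ltW l0)//; move: de1; clear -f2_gt0; lra.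
have mu2 : mu ^+ 2 <= lam ^+ 2 by rewrite lerXn2r ?nnegrE // ltW.
set s := expR th - 1.
have [sl s2th sQ] := tilt_bounds th0 thq; rewrite -/s in sl s2th sQ.
have su : s <= 4 * e by move: s2th th2; clear -f2_gt0; lra.
have s00 : 0 < s by move: sl th0; clear -f2_gt0; lra.
set p2 := poisson_pmf mu 2.
have p20 : 0 < p2 by exact: poisson_pmf_gt0.
have lam20 : 0 < lam ^+ 2 by exact: exprn_gt0.
have [p2l p2u] := pair_prob_bounds mu0 mul l1 e0 e1 mue; rewrite -/p2 in p2l p2u.
have sp2u : s * p2 <= 2 * e * lam ^+ 2.
  apply: (@le_trans _ _ (4 * e * (lam ^+ 2 / 2))); last by clear -f2_gt0; lra.
  by rewrite ler_pM// ltW.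
have U0 : 0 < lam ^+ 2 * e by rewrite mulr_gt0.
have V0 : 0 < lam ^+ 2 * e ^+ 2 by rewrite mulr_gt0// exprn_gt0.
have p2l4 : lam ^+ 2 / 4 <= p2.
  apply: le_trans p2l; have : lam ^+ 2 / 2 * (1/2) <= lam ^+ 2 / 2 * (1 - 2 * e - lam).
    by rewrite ler_wpM2l ?divr_ge0 ?sqr_ge0//; move: e16 l16 dl1; clear -f2_gt0; lra.
  clear -f2_gt0; lra.
have sp2l : lam ^+ 2 * e / 4 <= s * p2.
  apply: (@le_trans _ _ (e * (lam ^+ 2 / 4))); first by clear -f2_gt0; lra.
  by apply: ler_pM => //; [exact: ltW|rewrite divr_ge0 ?sqr_ge0|move: the sl; clear -f2_gt0; lra].
(* The error allowed for cutting the Poisson series at L. *)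
pose eta := dl * (lam ^+ 2 * e ^+ 2) * (F / (1 + F)).
have F1 : 0 < 1 + F by move: f2p; clear -f2_gt0; lra.
have eta0 : 0 < eta by rewrite /eta !mulr_gt0// invr_gt0.
have etaV : eta <= dl * (lam ^+ 2 * e ^+ 2).
  rewrite /eta ler_piMr//; first by rewrite mulr_ge0// ltW.
  by rewrite ler_pdivrMr// mul1r; move: f2p; clear -f2_gt0; lra.
have VU : lam ^+ 2 * e ^+ 2 <= lam ^+ 2 * e / 4.
  rewrite [leLHS](_ : _ = lam ^+ 2 * e * e); last by ring.
  by rewrite ler_wpM2l ?(ltW U0)//; move: e16 dl1; clear -f2_gt0; lra.
have dV : dl * (lam ^+ 2 * e ^+ 2) <= lam ^+ 2 * e / 4.
  by apply: le_trans VU; rewrite ler_piMl ?(ltW V0)//; move: dl1; clear -f2_gt0; lra.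
have etas : eta <= s * p2 by move: etaV dV sp2l; clear -f2_gt0; lra.
have etaE : eta = F * (dl * (lam ^+ 2 * e ^+ 2) / (1 + F)) by rewrite /eta; ring.
have eta1 : dl * (lam ^+ 2 * e ^+ 2) / (1 + F) <= dl * (lam ^+ 2 * e ^+ 2).
  apply: ler_piMr; first exact: mulr_ge0 (ltW dl0) (ltW V0).
  by rewrite invf_le1//; move: f2p; clear -f2_gt0; lra.
have etaF : eta <= F * (s * p2).
  by rewrite etaE ler_wpM2l ?(ltW f2p)//; move: eta1 dV sp2l; clear -f2_gt0; lra.
have etaU : eta <= F * dl * (lam ^+ 2 * e).
  rewrite etaE -[leRHS]mulrA ler_wpM2l ?(ltW f2p)//; apply: le_trans eta1 _.
  by rewrite ler_wpM2l ?(ltW dl0)//; move: VU U0; clear -f2_gt0; lra.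
have [L nL [LZ Lf]] := partial_sums_near (maxn n 2) mu0 eta0.
have {nL}[nL L2] : (n <= L)%N /\ (2 <= L)%N.
  by apply/andP; rewrite -geq_max.
set Z := \sum_k @tilted R mu th L k.
have ZE : Z = \sum_(k < L.+1) poisson_pmf mu k + s * p2.
  have := tilted_sum mu th (fun=> 1) L2; rewrite mulr1.
  by under eq_bigr do rewrite mulr1; under [in X in _ = X -> _]eq_bigr do rewrite mulr1.
have Zu : Z <= 1 + s * p2 by rewrite ZE lerD2r poisson_partial_le1.
have Zl : 1 + (s * p2 - eta) <= Z by rewrite ZE; move: LZ; clear -f2_gt0; lra.
have Z1 : 1 <= Z by move: Zl etas; clear -f2_gt0; lra.
have Z0 : 0 < Z by move: Z1; clear -f2_gt0; lra.
have bsum (g : nat -> R) : \sum_k @tilted R mu th L k / Z * g k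
    = (\sum_k @tilted R mu th L k * g k) / Z.
  by rewrite mulr_suml; apply: eq_bigr => k _; rewrite mulrAC.
have bsum_le (g : nat -> R) : tame g -> (forall k, 0 <= g k) ->
    \sum_k @tilted R mu th L k / Z * g k <= poisson_E mu g + s * p2 * g 2%N.
  exact: normalized_tilt_le.
pose D1 := N%:R * (lam ^+ 2 * e) * (dl * F).
pose D2 := n%:R * (dl * e) / 2.
pose D3 := N%:R * (lam ^+ 2 * e) * dl.
have D10 : 0 < D1 by rewrite /D1 !mulr_gt0.
have D20 : 0 < D2 by rewrite /D2 !mulr_gt0.
have D30 : 0 < D3 by rewrite /D3 !mulr_gt0.
have sp20 : 0 <= s * p2 by rewrite mulr_ge0 ?ltW.
have cinv (a b : R) : 0 < a -> 0 < b -> c <= a / b -> b <= v * a.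
  move=> a0 b0 cab; rewrite -ler_pdivrMr// ; apply: le_trans hv.
  by rewrite -[b / a]invf_div lef_pV2 ?posrE ?divr_gt0.
have lam3 : lam ^+ 3 * e = lam * (lam ^+ 2 * e) by ring.
have EmuU : poisson_E mu f <= C' * lam ^+ 2.
  have := hC3 mu mu0 mu1; rewrite ler_norml => /andP[_].
  have : F / 2 * mu ^+ 2 <= F / 2 * lam ^+ 2 by rewrite ler_wpM2l// divr_ge0// ltW.
  have : C3 * mu ^+ 3 <= C3 * lam ^+ 2.
    by rewrite ler_wpM2l//; apply: le_trans mu2; rewrite ler_wiXn2l// ltW.
  rewrite /C'; clear -f2_gt0; lra.
have EmuL : poisson_E lam f - 2 * C2 * dl * (lam ^+ 2 * e) <= poisson_E mu f.
  have [c' hc' hx] := hC2 lam l0 l1.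
  have x2 : `|- (dl * e)| <= 2^-1 by rewrite normrN gtr0_norm//; move: de1 e16 dl1; clear -f2_gt0; lra.
  have := hx _ x2; rewrite -/mu sqrrN ler_norml => /andP[+ _].
  have : c' * (dl * e) <= C2 * lam ^+ 2 * (dl * e).
    by rewrite ler_wpM2r ?(ltW de0)//; apply: le_trans hc'; exact: ler_norm.
  have : C2 * lam ^+ 3 * (dl * e) ^+ 2 <= C2 * lam ^+ 2 * (dl * e).
    apply: ler_pM; rewrite ?sqr_ge0 ?mulr_ge0 ?exprn_ge0 ?(ltW l0)//.
      by rewrite ler_wpM2l// ler_wiXn2l// ltW.
    by rewrite expr2 ler_piMl ?(ltW de0)//; move: de1 e1; clear -f2_gt0; lra.
  have : 0 <= F / 2 * lam ^+ 2 * (dl * e) ^+ 2.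
    by rewrite mulr_ge0 ?sqr_ge0// mulr_ge0 ?sqr_ge0// divr_ge0// ltW.
  clear -f2_gt0; lra.
have v240 : 240 <= v * dl ^+ 2.
  by apply: (cinv _ _ _ (ltr0n R 240) cD); rewrite exprn_gt0.
have m1 : T + D1 <= N%:R * \sum_k @tilted R mu th L k / Z * f k.
  suff cell : poisson_E lam f + F / 2 * lam ^+ 2 * e + C1 * lam ^+ 3 * e
      + lam ^+ 2 * e * (dl * F) <= \sum_k @tilted R mu th L k / Z * f k.
    have := ler_wpM2l (ltW N0R) cell; rewrite /D1; move: hT; clear -f2_gt0; lra.
  rewrite bsum tilted_sum// -/s -/p2 -/F.
  set Sf := (X in _ <= X / Z); pose A := poisson_E mu f - eta + s * p2 * F.
  have AS : A <= Sf by rewrite /A /Sf lerD2r.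
  have Emu0 : 0 <= poisson_E mu f.
    rewrite -(poisson_E_cst mu 0); apply: poisson_E_le => //.
    + exact: tame_cst.
    + exact: ck_tame.
    + by move=> k; exact: ck_ge0.
  have A0 : 0 <= A by rewrite /A; move: Emu0 etaF; clear -f2_gt0; lra.
  have AZ : A * (1 - s * p2) <= Sf / Z.
    rewrite ler_pdivlMr//; apply: le_trans AS; rewrite -mulrA ler_piMr//.
    apply: (@le_trans _ _ ((1 - s * p2) * (1 + s * p2))).
      rewrite ler_wpM2l//; have : 2 * e * lam ^+ 2 <= 2 * e * 1 by rewrite ler_wpM2l ?mulr_ge0 ?(ltW e0)//; move: lsq dl1; clear -f2_gt0; lra.
      move: sp2u e16 dl1; clear -f2_gt0; lra.
    by rewrite -subr_sqr expr1n gerBl sqr_ge0.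
  apply: le_trans AZ.
  have CF0 : 0 <= C' + 2 * F by rewrite addr_ge0// mulr_ge0// ltW.
  have Au : A <= (C' + 2 * F) * lam ^+ 2.
    have : F * (s * p2) <= F * (2 * e * lam ^+ 2) by rewrite ler_wpM2l// ltW.
    have : F * (lam ^+ 2 * e) <= F * (lam ^+ 2 * 1) by rewrite ler_wpM2l ?(ltW f2p)// ler_wpM2l// ltW.
    rewrite /A; move: EmuU eta0; clear -f2_gt0; lra.
  have hA : A * (s * p2) <= 2 * (C' + 2 * F) * (lam * (lam ^+ 2 * e)).
    apply: (@le_trans _ _ ((C' + 2 * F) * lam ^+ 2 * (2 * e * lam ^+ 2))).
      by apply: ler_pM.
    rewrite (_ : _ * _ * _ = 2 * (C' + 2 * F) * (lam ^+ 2 * (lam ^+ 2 * e))); last by ring.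
    rewrite ler_wpM2l ?mulr_ge0// ler_wpM2r ?(ltW U0)//.
    by rewrite expr2 ler_piMl// ltW.
  have hCM : (C1 + 2 * (C' + 2 * F) + 3 * F) * ((lam + e) * (lam ^+ 2 * e)) <= dl * F * (lam ^+ 2 * e).
    rewrite -/CM [leLHS](_ : _ = CM * (lam + e) * (lam ^+ 2 * e)); last by rewrite !mulrA.
    rewrite ler_wpM2r ?(ltW U0)//.
    apply: (@le_trans _ _ (CM * (2 * c))); first by rewrite ler_wpM2l ?(ltW CM0)//; move: lamc ec; clear -f2_gt0; lra.
    by move: cB; rewrite ler_pdivlMr ?mulr_gt0//; clear -f2_gt0; lra.
  have hsp : F / 2 * (lam ^+ 2 * e) * (1 + B0 * dl - 2 * (2 * e + lam)) <= s * p2 * F.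
    rewrite [leLHS](_ : _ = (1 + B0 * dl - 2 * (2 * e + lam)) * (e * (lam ^+ 2 / 2)) * F); last by ring.
    rewrite ler_wpM2r ?(ltW f2p)//.
    apply: (@le_trans _ _ (th * (lam ^+ 2 / 2 * (1 - 2 * e - lam)))).
      rewrite /th [leRHS](_ : _ = (1 + B0 * dl) * (1 - 2 * e - lam) * (e * (lam ^+ 2 / 2))); last by ring.
      apply: ler_wpM2r; first by apply: mulr_ge0 (ltW e0) _; rewrite divr_ge0 ?(ltW lam20).
      have : B0 * dl * (2 * e + lam) <= 1 * (2 * e + lam) by rewrite ler_wpM2r//; move: Bdl e0 l0; clear -f2_gt0; lra.
      clear -f2_gt0; lra.
    apply: (@le_trans _ _ (th * p2)); first by rewrite ler_wpM2l// ltW.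
    by rewrite ler_wpM2r// ltW.
  have FB : F * B0 = 6 * F + 4 * C2 by rewrite /B0; field; rewrite gt_eqF.
  have hsp' : F / 2 * (lam ^+ 2 * e) + (3 * F + 2 * C2) * dl * (lam ^+ 2 * e)
       - F * (lam ^+ 2 * e) * (2 * e + lam) <= s * p2 * F.
    apply: le_trans hsp; rewrite le_eqVlt; apply/orP; left; apply/eqP.
    rewrite [RHS](_ : _ = F / 2 * (lam ^+ 2 * e) + (F * B0) / 2 * dl * (lam ^+ 2 * e)
       - F * (lam ^+ 2 * e) * (2 * e + lam)); last by field.
    by rewrite FB; field.
  have := mulr_ge0 (ltW f2p) (mulr_ge0 (ltW l0) (ltW U0)).
  have := mulr_ge0 (ltW f2p) (mulr_ge0 (ltW e0) (ltW U0)).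
  have := mulr_ge0 (addr_ge0 C10 (mulr_ge0 (ler0n R 2) CF0)) (mulr_ge0 (ltW e0) (ltW U0)).
  rewrite -[C1 * _ * e]mulrA lam3 mulrBr mulr1 {1}/A.
  move: EmuL etaU hsp' hA hCM; clear -f2_gt0; lra.
have v1 : N%:R * (\sum_k @tilted R mu th L k / Z * f k ^+ 2) <= D1 ^+ 2 / 6.
  have h : \sum_k @tilted R mu th L k / Z * f k ^+ 2 <= CV * lam ^+ 2.
    apply: le_trans (bsum_le (fun k => f k ^+ 2) tf2 (fun=> sqr_ge0 _)) _.
    have := hC4 mu mu0 mu1; rewrite ler_norml => /andP[_].
    have : F ^+ 2 / 2 * mu ^+ 2 <= F ^+ 2 / 2 * lam ^+ 2.
      by rewrite ler_wpM2l// divr_ge0// sqr_ge0.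
    have : C4 * mu ^+ 3 <= C4 * lam ^+ 2.
      by rewrite ler_wpM2l//; apply: le_trans mu2; rewrite ler_wiXn2l// ltW.
    have : s * p2 * F ^+ 2 <= 2 * lam ^+ 2 * F ^+ 2.
      rewrite ler_wpM2r ?sqr_ge0//; apply: le_trans sp2u _.
      rewrite ler_wpM2r ?(ltW lam20)//; move: e1; clear -f2_gt0; lra.
    rewrite /CV -/F; clear -f2_gt0; lra.
  apply: le_trans (ler_wpM2l (ltW N0R) h) _.
  have hv' : 6 * CV <= v * (dl ^+ 2 * F ^+ 2).
    by apply: cinv => //; rewrite mulr_gt0 ?exprn_gt0.
  have -> : D1 ^+ 2 / 6 = N%:R * lam ^+ 2 * (v * (dl ^+ 2 * F ^+ 2)) / 6.
    by rewrite /D1 vE; field.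
  have := ler_wpM2l (mulr_ge0 (ltW N0R) (ltW lam20)) hv'; clear -f2_gt0; lra.
have m2 : N%:R * (\sum_k @tilted R mu th L k / Z * k%:R) + D2 <= n%:R.
  have := bsum_le (fun k => k%:R) (@tame_id R) (fun=> ler0n _ _).
  rewrite poisson_E_id// => h.
  have h2 : \sum_k @tilted R mu th L k / Z * k%:R <= lam * (1 - dl * e) + 4 * e * lam ^+ 2.
    by apply: le_trans h _; rewrite -[1 - _]/(1 + - _) -/mu; move: sp2u; clear -f2_gt0; lra.
  have := ler_wpM2l (ltW N0R) h2.
  have hl : N%:R * lam * e * (4 * lam) <= N%:R * lam * e * (dl / 2).
    by rewrite ler_wpM2l ?mulr_ge0 ?(ltW e0) ?(ltW l0)//; move: l16 dl0; clear -f2_gt0; lra.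
  rewrite /D2 nE; move: hl; clear -f2_gt0; lra.
have v2 : N%:R * (\sum_k @tilted R mu th L k / Z * k%:R ^+ 2) <= D2 ^+ 2 / 6.
  have tid2 : tame (fun k => k%:R ^+ 2 : R) by apply: tame_mul; exact: tame_id.
  have := bsum_le (fun k => k%:R ^+ 2) tid2 (fun=> sqr_ge0 _).
  rewrite poisson_E_sqr// => h.
  have h2 : \sum_k @tilted R mu th L k / Z * k%:R ^+ 2 <= 10 * lam.
    apply: le_trans h _; have : mu ^+ 2 <= lam by rewrite expr2 -[lam]mul1r ler_pM// ltW.
    have : e * lam ^+ 2 <= 1 * lam.
      by apply: ler_pM => //; rewrite ?(ltW e0) ?(ltW lam20)// expr2 ler_piMl// ltW.
    move: sp2u mul; clear -f2_gt0; lra.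
  apply: le_trans (ler_wpM2l (ltW N0R) h2) _.
  have -> : D2 ^+ 2 / 6 = n%:R * (n%:R * e ^+ 2 * dl ^+ 2) / 24 by rewrite /D2; field.
  have : v * dl ^+ 2 <= n%:R * e ^+ 2 * dl ^+ 2.
    rewrite ler_wpM2r ?sqr_ge0// /v ler_wpM2r ?sqr_ge0//.
    by rewrite -[leRHS]mulr1 ler_wpM2l.
  move=> hn; have := ler_wpM2l (ltW n0R) (le_trans v240 hn); rewrite [X in X * 240]nE; move: lam20; clear -f2_gt0; lra.
have m3 : N%:R * (\sum_k @tilted R mu th L k / Z * is_pair k) <= N%:R * (expR th * p2).
  have tp : tame (fun k => is_pair k : R).
    apply: (tame_le (tame_cst 1)) => k; rewrite normr1 normr_nat lern1.
    by case: (_ == _).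
  have := bsum_le (fun k => is_pair k) tp (fun=> ler0n _ _).
  rewrite poisson_E_pmf// -/p2 => h; rewrite ler_wpM2l//; apply: le_trans h _.
  by rewrite /is_pair eqxx mulr1 /s; clear -f2_gt0; lra.
have v3 : N%:R * (\sum_k @tilted R mu th L k / Z * is_pair k) <= D3 ^+ 2 / 6.
  apply: le_trans m3 _.
  have -> : D3 ^+ 2 / 6 = N%:R * (lam ^+ 2 * (v * dl ^+ 2) / 6) by rewrite /D3 vE; field.
  rewrite ler_wpM2l//; apply: (@le_trans _ _ (2 * (lam ^+ 2 / 2))).
    by apply: ler_pM; rewrite ?expR_ge0 ?(ltW p20)//; rewrite /s in su; move: su e16 dl1 sp2u p2u; clear -f2_gt0; lra.
  have := ler_wpM2l (ltW lam20) v240; move: lam20; clear -f2_gt0; lra.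
have := tilted_lower fP N0 nL mu0 (ltW th0) D10 D20 D30 m1 v1 m2 v2
   (lerD m3 (lexx D3)) v3.
apply: le_trans; rewrite ler_wpM2l ?invr_ge0// -/Z.
set y := s * p2 - eta in Zl.
have y0 : 0 <= y by rewrite /y; move: etas; clear -f2_gt0; lra.
have ys : y <= s * p2 by rewrite /y; move: eta0; clear -f2_gt0; lra.
have y1 : y <= 2^-1.
  apply: le_trans ys _; apply: le_trans sp2u _.
  have : 2 * e * lam ^+ 2 <= 2 * e * 1 by rewrite ler_wpM2l ?mulr_ge0 ?(ltW e0)//; move: lsq dl1; clear -f2_gt0; lra.
  move: e16 dl1; clear -f2_gt0; lra.
have hZ : expR (N%:R * (y - 2 * y ^+ 2)) <= Z ^+ N.
  rewrite expRM_natl lerXn2r ?nnegrE ?expR_ge0 ?(ltW Z0)//.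
  by apply: le_trans Zl; exact: expR_log_lower.
apply: le_trans (ler_wpM2r (expR_ge0 _) hZ); rewrite -expRD ler_expR.
have yq : 2 * y ^+ 2 <= dl / 2 * (lam ^+ 2 * e ^+ 2).
  have : y ^+ 2 <= (2 * e * lam ^+ 2) ^+ 2.
    have yU := le_trans ys sp2u.
    by rewrite lerXn2r ?nnegrE// (le_trans y0 yU).
  have := ler_wpM2l (ltW V0) lsq.
  rewrite (_ : (2 * e * lam ^+ 2) ^+ 2 = 4 * (lam ^+ 2 * e ^+ 2 * lam ^+ 2)); last by ring.
  move: ys; clear -f2_gt0; lra.
have thsq : th ^+ 2 <= (1 + 3 * (B0 * dl)) * e ^+ 2.
  rewrite /th exprMn ler_wpM2r ?sqr_ge0//.
  have : (B0 * dl) * (B0 * dl) <= (B0 * dl) * 1 by rewrite ler_wpM2l//; move: Bdl; clear -f2_gt0; lra.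
  clear -f2_gt0; lra.
pose Q := th ^+ 2 / 2 * (1 + th).
have Qu : Q <= (1 + 3 * (B0 * dl) + 4 * e) * e ^+ 2 / 2.
  apply: (@le_trans _ _ ((1 + 3 * (B0 * dl)) * e ^+ 2 / 2 * (1 + 2 * e))).
    apply: ler_pM; rewrite ?divr_ge0 ?sqr_ge0//; move: Bd0 Bdl th0 th2 thsq; clear -f2_gt0; lra.
  have : 3 * (B0 * dl) * (e ^+ 2 * e) <= 1 * (e ^+ 2 * e).
    by rewrite ler_wpM2r ?mulr_ge0 ?sqr_ge0 ?(ltW e0)//; move: Bdl; clear -f2_gt0; lra.
  clear -f2_gt0; lra.
have Q0 : 0 <= Q by rewrite /Q mulr_ge0 ?divr_ge0 ?sqr_ge0//; move: th0; clear -f2_gt0; lra.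
have pQ : - ((1 + 3 * (B0 * dl) + 4 * e) / 4 * (lam ^+ 2 * e ^+ 2)) <= p2 * (s - th * expR th).
  apply: (@le_trans _ _ (- (p2 * Q))); last by rewrite -mulrN ler_wpM2l// ltW.
  rewrite lerN2; apply: (@le_trans _ _ (lam ^+ 2 / 2 * ((1 + 3 * (B0 * dl) + 4 * e) * e ^+ 2 / 2))).
    by apply: ler_pM => //; exact: ltW.
  by rewrite le_eqVlt; apply/orP; left; apply/eqP; field.
have tU : th * ((lam ^+ 2 * e) * dl) <= 2 * dl * (lam ^+ 2 * e ^+ 2).
  rewrite [leRHS](_ : _ = 2 * e * (lam ^+ 2 * e * dl)); last by ring.
  by rewrite ler_wpM2r// mulr_ge0 ?ltW.
have cell : - (lam ^+ 2 * e ^+ 2 * (4^-1 + (3 * B0 + 5) * dl)) <=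
   y - 2 * y ^+ 2 - th * (expR th * p2) - th * (lam ^+ 2 * e * dl).
  have : lam ^+ 2 * e ^+ 2 * e <= lam ^+ 2 * e ^+ 2 * (dl / 16) by rewrite ler_wpM2l// ltW.
  have : 0 <= lam ^+ 2 * e ^+ 2 * dl by rewrite mulr_ge0 ?ltW.
  have : 0 <= lam ^+ 2 * e ^+ 2 * (B0 * dl) by rewrite mulr_ge0// ltW.
  rewrite {1}/y; move: yq pQ tU etaV e16; clear -f2_gt0; lra.
have := ler_wpM2l (ltW N0R) cell; rewrite vE /D3; clear -f2_gt0; lra.
Qed.

End LowerBound.

(** * The correlation at small intensity *)

Section Rho.
Context {R : realType}.
Implicit Types (mu : R) (F G H : nat -> R).

Lemma poisson_covE mu F G : 0 < mu -> tame F -> tame G ->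
  poisson_cov mu F G = poisson_E mu (fun k => F k * G k) - poisson_E mu F * poisson_E mu G.
Proof.
move=> mu0 tF tG.
have L1 K : tame K -> K \in Lfun (poisson_prob mu 0) 1.
  by move=> [a _ aK]; exact: poisson_Lfun mu0 aK.
have LFG : (F * G)%R \in Lfun (poisson_prob mu 0) 1.
  by apply: L1; exact: tame_mul.
have f1 K : tame K -> ('E_(poisson_prob mu 0)[K])%E \is a fin_num.
  by move=> /L1; exact: expectation_fin_num.
have LF := L1 _ tF; have LG := L1 _ tG.
rewrite /poisson_cov (covarianceE LF LG LFG) fineB ?fineM ?fin_numM ?f1//.
exact: tame_mul.
Qed.

Lemma poisson_covC mu F G : 0 < mu -> tame F -> tame G ->
  poisson_cov mu F G = poisson_cov mu G F.
Proof.
move=> mu0 tF tG; rewrite !poisson_covE// mulrC; congr (_ - _).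
by congr poisson_E; apply/funext => k; rewrite mulrC.
Qed.

Lemma poisson_cov_lin mu (b c : R) F G H : 0 < mu -> tame F -> tame G -> tame H ->
  poisson_cov mu (fun k => b * F k + c * G k) H
  = b * poisson_cov mu F H + c * poisson_cov mu G H.
Proof.
move=> mu0 tF tG tH.
have tFH : tame (fun k => F k * H k) by exact: tame_mul.
have tGH : tame (fun k => G k * H k) by exact: tame_mul.
rewrite !poisson_covE//; last by apply: tame_add; exact: tame_scale.
rewrite poisson_E_lin//.
have -> : poisson_E mu (fun k => (b * F k + c * G k) * H k)
    = b * poisson_E mu (fun k => F k * H k) + c * poisson_E mu (fun k => G k * H k).
  rewrite -poisson_E_lin//; congr poisson_E; apply/funext => k.
  by rewrite mulrDl !mulrA.
ring.
Qed.

Lemma poisson_cov_linr mu (b c : R) F G H : 0 < mu -> tame F -> tame G -> tame H ->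
  poisson_cov mu H (fun k => b * F k + c * G k)
  = b * poisson_cov mu H F + c * poisson_cov mu H G.
Proof.
move=> mu0 tF tG tH; rewrite poisson_covC//; last by apply: tame_add; exact: tame_scale.
by rewrite poisson_cov_lin// (poisson_covC mu0 tF tH) (poisson_covC mu0 tG tH).
Qed.

Let sq (k : nat) : R := k%:R ^+ 2.
Let idr (k : nat) : R := k%:R.

Let tame_sq : tame sq. Proof. by apply: tame_mul; exact: tame_id. Qed.
Let tame_idr : tame idr. Proof. exact: tame_id. Qed.

Lemma poisson_E_cube mu : 0 < mu ->
  poisson_E mu (fun k => k%:R ^+ 3) = mu + 3 * mu ^+ 2 + mu ^+ 3.
Proof.
move=> mu0.
have sE : (fun k : nat => sq k.+1) = (fun k : nat => (1 * sq k + 2 * idr k) + 1) :> (nat -> R).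
  by apply/funext => k; rewrite /sq /idr -natr1; ring.
have t2 : tame (fun k => 1 * sq k + 2 * idr k) by apply: tame_add; exact: tame_scale.
have t1 : tame (fun k => sq k.+1) by rewrite sE; apply: tame_add => //; exact: tame_cst.
have -> : poisson_E mu (fun k => k%:R ^+ 3) = poisson_E mu (fun k => k%:R * sq k).
  by congr poisson_E; apply/funext => k; rewrite /sq -exprS.
rewrite (poisson_E_shift mu0 tame_sq t1) sE poisson_E_add//; last exact: tame_cst.
by rewrite poisson_E_lin// poisson_E_cst poisson_E_sqr// poisson_E_id//; ring.
Qed.

Lemma poisson_E_quartic mu : 0 < mu ->
  poisson_E mu (fun k => k%:R ^+ 4) = mu + 7 * mu ^+ 2 + 6 * mu ^+ 3 + mu ^+ 4.
Proof.
move=> mu0; pose cu (k : nat) : R := k%:R ^+ 3.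
have tcu : tame cu.
  rewrite (_ : cu = fun k => idr k * sq k); first exact: tame_mul.
  by apply/funext => k; rewrite /cu /sq /idr exprS.
have sE : (fun k : nat => cu k.+1)
    = (fun k : nat => (1 * cu k + 3 * sq k) + (3 * idr k + 1 * 1)) :> (nat -> R).
  by apply/funext => k; rewrite /cu /sq /idr -natr1; ring.
have t2 : tame (fun k => 1 * cu k + 3 * sq k) by apply: tame_add; exact: tame_scale.
have t3 : tame (fun k => 3 * idr k + 1 * 1).
  by apply: tame_add; [exact: tame_scale|exact: tame_cst].
have t1 : tame (fun k => cu k.+1) by rewrite sE; exact: tame_add.
have -> : poisson_E mu (fun k => k%:R ^+ 4) = poisson_E mu (fun k => k%:R * cu k).
  by congr poisson_E; apply/funext => k; rewrite /cu -exprS.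
rewrite (poisson_E_shift mu0 tcu t1) sE poisson_E_add// !poisson_E_lin//; last exact: tame_cst.
by rewrite poisson_E_cst poisson_E_sqr// poisson_E_id// poisson_E_cube//; ring.
Qed.

Lemma poisson_cov_idid mu : 0 < mu -> poisson_cov mu idr idr = mu.
Proof.
move=> mu0; rewrite poisson_covE// (_ : (fun k => _) = sq); last first.
  by apply/funext => k; rewrite /idr /sq expr2.
by rewrite poisson_E_sqr// poisson_E_id//; ring.
Qed.

Lemma poisson_cov_idsq mu : 0 < mu -> poisson_cov mu idr sq = mu + 2 * mu ^+ 2.
Proof.
move=> mu0; rewrite poisson_covE// (_ : (fun k => _) = fun k : nat => k%:R ^+ 3 :> R); last first.
  by apply/funext => k; rewrite /idr /sq -exprS.
by rewrite poisson_E_cube// poisson_E_sqr// poisson_E_id//; ring.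
Qed.

Lemma poisson_cov_sqsq mu : 0 < mu ->
  poisson_cov mu sq sq = mu + 6 * mu ^+ 2 + 4 * mu ^+ 3.
Proof.
move=> mu0; rewrite poisson_covE// (_ : (fun k => _) = fun k : nat => k%:R ^+ 4 :> R); last first.
  by apply/funext => k; rewrite /sq -exprD.
by rewrite poisson_E_quartic// poisson_E_sqr//; ring.
Qed.

(** Subtracting tau xi removes the linear part of the statistic.  The other
    argument of the correlation is, up to a constant, the second Charlier
    polynomial: it is uncorrelated with xi and has variance 2 mu^2. *)
Lemma rho_affine mu (al be : R) F : 0 < mu -> al != 0 -> tame F ->
  let cfx := poisson_cov mu F idr in
  let cff := poisson_cov mu F F - cfx ^+ 2 / mu in
  0 <= cff ->
  rho mu (fun k => al * F k + be * k%:R) ^+ 2 =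
  (poisson_cov mu F sq - (2 * mu + 1) * cfx) ^+ 2 / (2 * mu ^+ 2 * cff).
Proof.
move=> mu0 al0 tF cfx cff cff0.
have mun0 : mu != 0 by rewrite gt_eqF.
set h := fun k : nat => _.
have tauE : tau mu h = al * (cfx / mu) + be.
  rewrite /tau /h -/idr (poisson_cov_lin al be mu0 tF tame_idr tame_idr).
  by rewrite poisson_cov_idid// -/cfx; field.
rewrite /rho /poisson_corr.
have -> : (fun x : nat => h x - tau mu h * x%:R)
   = (fun k => al * F k + (- al * (cfx / mu)) * idr k).
  by apply/funext => k; rewrite tauE /h /idr; ring.
have -> : (fun x : nat => x%:R ^+ 2 - (2 * mu + 1) * x%:R)
   = (fun k => 1 * sq k + (- (2 * mu + 1)) * idr k).
  by apply/funext => k; rewrite /sq /idr; ring.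
set u := fun k => al * F k + _; set w := fun k => 1 * sq k + _.
have tu : tame u by apply: tame_add; exact: tame_scale.
have tw : tame w by apply: tame_add; exact: tame_scale.
have cww : poisson_cov mu w w = 2 * mu ^+ 2.
  rewrite {1}/w poisson_cov_lin// /w !poisson_cov_linr// (poisson_covC mu0 tame_sq tame_idr).
  by rewrite poisson_cov_idid// poisson_cov_idsq// poisson_cov_sqsq//; ring.
have cuw : poisson_cov mu u w = al * (poisson_cov mu F sq - (2 * mu + 1) * cfx).
  rewrite /u poisson_cov_lin// /w !poisson_cov_linr//.
  by rewrite poisson_cov_idid// poisson_cov_idsq// -/cfx; ring.
have cuu : poisson_cov mu u u = al ^+ 2 * cff.
  rewrite {1}/u poisson_cov_lin// /u !poisson_cov_linr// (poisson_covC mu0 tame_idr tF).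
  by rewrite poisson_cov_idid// -/cfx /cff; field.
rewrite cww cuw cuu expr_div_n sqr_sqrtr; last first.
  by apply: mulr_ge0; [exact: mulr_ge0 (sqr_ge0 _) cff0|exact: mulr_ge0 (ler0n _ _) (sqr_ge0 _)].
rewrite exprMn (_ : al ^+ 2 * cff * (2 * mu ^+ 2) = al ^+ 2 * (2 * mu ^+ 2 * cff)); last by ring.
by rewrite -mulf_div divff ?mul1r// expf_neq0.
Qed.

(** Both the covariance of F with the Charlier polynomial and its own residual
    variance come from pairs at leading order: they are F(2) mu^2 and
    F(2)^2 mu^2 / 2, up to O(mu^3). *)
Lemma rho_sqr_near1 F : collision_kernel F -> forall z, 0 < z -> exists2 c, 0 < c &
  forall mu al be, 0 < mu -> mu <= c -> al != 0 ->
  `|rho mu (fun k => al * F k + be * k%:R) ^+ 2 - 1| <= z.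
Proof.
move=> FP z z0; have tF := ck_tame FP; have F0 := ck0 FP; have F1 := ck1 FP.
have f2 := ck2 FP; set f := F 2%N in f2.
have tFF : tame (fun k => F k * F k) by exact: tame_mul.
have tFx : tame (fun k => F k * idr k) by exact: tame_mul.
have tFs : tame (fun k => F k * sq k) by exact: tame_mul.
have z00 (G : R) : F 0%N * G = 0 by rewrite F0 mul0r.
have z11 (G : R) : F 1%N * G = 0 by rewrite F1 mul0r.
have [C1 C10 h1] := poisson_E_order2 tF F0 F1.
have [C2 C20 h2] := poisson_E_order2 tFF (z00 _) (z11 _).
have [C3 C30 h3] := poisson_E_order2 tFx (z00 _) (z11 _).
have [C4 C40 h4] := poisson_E_order2 tFs (z00 _) (z11 _).
pose K1 := f / 2 + C1. pose K3 := f + C3.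
have K10 : 0 <= K1 by rewrite addr_ge0// divr_ge0// ltW.
have K30 : 0 <= K3 by rewrite addr_ge0// ltW.
pose A := C4 + C3 + 2 * K3 + 2 * K1.
pose B := 2 * C2 + 2 * K1 ^+ 2 + 2 * (K3 + K1) ^+ 2.
have A0 : 0 <= A by rewrite /A !addr_ge0// mulr_ge0.
have B0 : 0 <= B by rewrite /B !addr_ge0// mulr_ge0 ?sqr_ge0.
pose D := 2 * f * A + A ^+ 2 + B + 1.
have D0 : 0 < D.
  rewrite /D ltr_wpDl//; apply: addr_ge0 => //; apply: addr_ge0 (sqr_ge0 _).
  by apply: mulr_ge0 => //; apply: mulr_ge0 => //; exact: ltW.
have ff : 0 < f ^+ 2 by rewrite exprn_gt0.
exists (Num.min 1 (Num.min (f ^+ 2 / (2 * (B + 1))) (z * f ^+ 2 / (2 * D)))).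
  by rewrite !lt_min ltr01/= !divr_gt0 ?mulr_gt0// ltr_wpDl.
move=> mu al be mu0; rewrite !le_min => /and3P[mu1 muB muD] al0.
have mun0 : mu != 0 by rewrite gt_eqF.
have m2 : 0 < mu ^+ 2 by rewrite exprn_gt0.
have m32 : mu ^+ 3 <= mu ^+ 2 by rewrite ler_wiXn2l// ltW.
have := h1 mu mu0 mu1; set E1 := poisson_E mu F => e1.
have := h2 mu mu0 mu1; set E2 := poisson_E mu _ => e2.
have := h3 mu mu0 mu1; set E3 := poisson_E mu _ => e3.
have := h4 mu mu0 mu1; set E4 := poisson_E mu _ => e4.
have covx : poisson_cov mu F idr = E3 - E1 * mu.
  by rewrite poisson_covE// poisson_E_id.
have covs : poisson_cov mu F sq = E4 - E1 * (mu + mu ^+ 2).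
  by rewrite poisson_covE// poisson_E_sqr.
have covf : poisson_cov mu F F = E2 - E1 ^+ 2.
  by rewrite poisson_covE// -expr2.
rewrite /sq /idr -/f in e1 e2 e3 e4.
set cfx := E3 - E1 * mu in covx.
have m30 : 0 < mu ^+ 3 by rewrite exprn_gt0.
have hE1 : `|E1| <= K1 * mu ^+ 2.
  rewrite -[E1](subrK (f / 2 * mu ^+ 2)); apply: le_trans (ler_normD _ _) _.
  rewrite (ger0_norm (mulr_ge0 (divr_ge0 (ltW f2) (ler0n R 2)) (ltW m2))).
  have := ler_wpM2l C10 m32; move: e1; rewrite /K1; clear; lra.
have hE3' : `|E3 - f * mu ^+ 2| <= C3 * mu ^+ 3.
  by move: e3; rewrite (_ : f * 2 / 2 * mu ^+ 2 = f * mu ^+ 2)//; field.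
have hE3 : `|E3| <= K3 * mu ^+ 2.
  rewrite -[E3](subrK (f * mu ^+ 2)); apply: le_trans (ler_normD _ _) _.
  rewrite (ger0_norm (mulr_ge0 (ltW f2) (ltW m2))).
  have := ler_wpM2l C30 m32; move: hE3'; rewrite /K3; clear; lra.
have hE4 : `|E4 - 2 * f * mu ^+ 2| <= C4 * mu ^+ 3.
  by move: e4; rewrite (_ : f * 2 ^+ 2 / 2 * mu ^+ 2 = 2 * f * mu ^+ 2)//; field.
have hE2 : `|E2 - f ^+ 2 / 2 * mu ^+ 2| <= C2 * mu ^+ 3.
  by move: e2; rewrite -expr2.
have hcfx : `|cfx| <= (K3 + K1) * mu ^+ 2.
  apply: le_trans (ler_normB _ _) _; rewrite mulrDl lerD//.
  by rewrite normrM (gtr0_norm mu0) -[leRHS]mulr1 ler_pM ?(ltW mu0).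
pose cfw := poisson_cov mu F sq - (2 * mu + 1) * cfx.
pose a := cfw - f * mu ^+ 2.
have ha : `|a| <= A * mu ^+ 3.
  rewrite /a /cfw covs (_ : _ - _ = (E4 - 2 * f * mu ^+ 2) + - (E3 - f * mu ^+ 2)
     + (- (2 * mu * E3)) + mu ^+ 2 * E1); last by rewrite /cfx; ring.
  apply: le_trans (ler_normD _ _) _.
  rewrite [leRHS](_ : _ = C4 * mu ^+ 3 + C3 * mu ^+ 3 + 2 * K3 * mu ^+ 3 + 2 * K1 * mu ^+ 3); last by rewrite /A; ring.
  apply: lerD; last first.
    rewrite normrM (gtr0_norm m2).
    have h : mu ^+ 2 * `|E1| <= mu ^+ 1 * (K1 * mu ^+ 2).
      by apply: ler_pM; rewrite ?(ltW m2)// ler_wiXn2l// ltW.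
    by apply: le_trans h _; have := mulr_ge0 K10 (ltW m30); clear; lra.
  apply: le_trans (ler_normD _ _) _; apply: lerD; last first.
    rewrite normrN !normrM normr_nat (gtr0_norm mu0).
    rewrite [leRHS](_ : _ = 2 * mu * (K3 * mu ^+ 2)); last by ring.
    by rewrite ler_wpM2l// mulr_ge0// ltW.
  by apply: le_trans (ler_normD _ _) _; rewrite normrN lerD.
pose cff := poisson_cov mu F F - cfx ^+ 2 / mu.
pose b := 2 * cff - f ^+ 2 * mu ^+ 2.
have sqK x K : `|x| <= K -> x ^+ 2 <= K ^+ 2 :> R.
  move=> xK; rewrite -[x ^+ 2]real_normK ?num_real// lerXn2r ?nnegrE//.
  exact: le_trans xK.
have hb : `|b| <= B * mu ^+ 3.
  rewrite /b /cff covf (_ : _ - _ = 2 * (E2 - f ^+ 2 / 2 * mu ^+ 2)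
     + (- (2 * E1 ^+ 2)) + (- (2 * (cfx ^+ 2 / mu)))); last by field.
  apply: le_trans (ler_normD _ _) _.
  rewrite [leRHS](_ : _ = 2 * C2 * mu ^+ 3 + 2 * K1 ^+ 2 * mu ^+ 3 + 2 * (K3 + K1) ^+ 2 * mu ^+ 3); last by rewrite /B; ring.
  apply: lerD; last first.
    rewrite normrN normrM normr_nat -[leRHS]mulrA ler_wpM2l// ger0_norm; last first.
      by rewrite divr_ge0 ?sqr_ge0// ltW.
    rewrite ler_pdivrMr//; apply: le_trans (sqK _ _ hcfx) _.
    by rewrite le_eqVlt; apply/orP; left; apply/eqP; ring.
  apply: le_trans (ler_normD _ _) _; apply: lerD.
    by rewrite normrM normr_nat -[leRHS]mulrA ler_wpM2l.
  rewrite normrN normrM normr_nat -[leRHS]mulrA ler_wpM2l// ger0_norm ?sqr_ge0//.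
  apply: le_trans (sqK _ _ hE1) _; rewrite exprMn ler_wpM2l ?sqr_ge0//.
  by rewrite -exprM ler_wiXn2l// ltW.
have hB : B * mu <= f ^+ 2 / 2.
  move: muB; rewrite ler_pdivlMr; last by rewrite mulr_gt0// ltr_wpDl.
  by move: mu0; clear; lra.
have hbl : f ^+ 2 / 2 * mu ^+ 2 <= f ^+ 2 * mu ^+ 2 + b.
  have := ler_wpM2r (ltW m2) hB.
  move: hb; rewrite ler_norml (_ : B * mu ^+ 3 = B * mu * mu ^+ 2); last by ring.
  by move=> /andP[+ _]; clear; lra.
have hpos : 0 < f ^+ 2 * mu ^+ 2 + b.
  by apply: lt_le_trans hbl; rewrite mulr_gt0 ?divr_gt0.
have cff0 : 0 <= cff by move: hpos; rewrite /b; clear; lra.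
rewrite (rho_affine be mu0 al0 tF); last by rewrite covx.
rewrite covx -/cff -/cfw.
have -> : cfw = f * mu ^+ 2 + a by rewrite /a; ring.
have -> : 2 * mu ^+ 2 * cff = mu ^+ 2 * (f ^+ 2 * mu ^+ 2 + b) by rewrite /b; ring.
set Q := _ + b in hbl hpos *.
have -> : (f * mu ^+ 2 + a) ^+ 2 / (mu ^+ 2 * Q) - 1
    = (2 * f * mu ^+ 2 * a + a ^+ 2 - mu ^+ 2 * b) / (mu ^+ 2 * Q).
  have Qn0 : Q != 0 by rewrite gt_eqF.
  have bE : b = Q - f ^+ 2 * mu ^+ 2 by rewrite /Q; ring.
  by rewrite bE; field; rewrite mun0 Qn0.
rewrite normrM normfV (gtr0_norm (mulr_gt0 m2 hpos)) ler_pdivrMr ?mulr_gt0//.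
apply: (@le_trans _ _ (D * mu ^+ 5)).
  have m5 : 0 <= mu ^+ 5 by rewrite exprn_ge0// ltW.
  apply: (@le_trans _ _ (2 * f * A * mu ^+ 5 + A ^+ 2 * mu ^+ 5 + B * mu ^+ 5)); last first.
    rewrite [leRHS](_ : _ = 2 * f * A * mu ^+ 5 + A ^+ 2 * mu ^+ 5 + B * mu ^+ 5 + mu ^+ 5); last by rewrite /D; ring.
    by rewrite lerDl.
  apply: le_trans (ler_normB _ _) _; apply: lerD; last first.
    rewrite normrM (gtr0_norm m2) [leRHS](_ : _ = mu ^+ 2 * (B * mu ^+ 3)); last by ring.
    by rewrite ler_wpM2l// ltW.
  apply: le_trans (ler_normD _ _) _; apply: lerD.
    rewrite normrM ger0_norm; last first.
      by rewrite mulr_ge0 ?(ltW m2)// mulr_ge0// ltW.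
    rewrite [leRHS](_ : _ = 2 * f * mu ^+ 2 * (A * mu ^+ 3)); last by ring.
    by rewrite ler_wpM2l// mulr_ge0 ?(ltW m2)// mulr_ge0// ltW.
  rewrite ger0_norm ?sqr_ge0//; apply: le_trans (sqK _ _ ha) _.
  by rewrite exprMn ler_wpM2l ?sqr_ge0// -exprM ler_wiXn2l// ltW.
apply: (@le_trans _ _ (z * (mu ^+ 2 * (f ^+ 2 / 2 * mu ^+ 2)))); last first.
  by rewrite ler_wpM2l ?(ltW z0)// ler_wpM2l// ltW.
rewrite [leLHS](_ : _ = D * mu * mu ^+ 4); last by ring.
rewrite [leRHS](_ : _ = z * f ^+ 2 / 2 * mu ^+ 4); last by field.
rewrite ler_wpM2r ?exprn_ge0 ?(ltW mu0)//.
by move: muD; rewrite ler_pdivlMr ?mulr_gt0//; clear; lra.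
Qed.

End Rho.

(** * The power divergence kernel *)

Section PowerDivergence.
Context {R : realType}.
Context (d : R).
Context (hd : -1 < d).

Definition power_kernel : nat -> R := power_div d 1.

Lemma power_kernelE k : d != 0 -> power_kernel k = 2 / (d * (d + 1)) * (k%:R * (k%:R `^ d - 1)).
Proof. by move=> d0; rewrite /power_kernel /power_div (negbTE d0) divr1 !mulrA. Qed.

(** Rescaling the argument of a power only produces a factor and a linear term;
    for d = 0 the factor is 1 and the linear term comes from the logarithm. *)
Lemma power_div_affine lam : 0 < lam -> exists be, forall k,
  power_div d lam k = (lam^-1) `^ d * power_kernel k + be * k%:R.
Proof.
move=> l0; have [d0|d0] := eqVneq d 0.
  exists (- (2 * ln lam)) => -[|k]; rewrite /power_kernel /power_div d0 eqxx powRr0 mul1r.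
    by rewrite !(mulr0, mul0r, addr0).
  by rewrite divr1 ln_div ?posrE// ; ring.
exists (2 / (d * (d + 1)) * ((lam^-1) `^ d - 1)) => k.
rewrite power_kernelE// /power_div (negbTE d0) powRM ?invr_ge0 ?(ltW l0)//.
set a := 2 / _; ring.
Qed.

Let d10 : 0 < d + 1. Proof. by rewrite -ltrBlDr sub0r. Qed.

Lemma power_kernel_growth : exists2 B, 0 < B & forall k,
  `|power_kernel k| <= B * k%:R * k%:R `^ (Num.max 1 d).
Proof.
have [d0|d0] := eqVneq d 0.
  exists 2 => // -[|k]; rewrite /power_kernel /power_div d0 eqxx divr1.
    by rewrite !(mulr0, mul0r) normr0.
  rewrite (max_l (ler01 : (0 : R) <= 1)) powRr1// !normrM normr_nat normr_nat.
  by rewrite ler_wpM2l// ger0_norm ?ln_ge0 ?ler1n// ltW// ln_sublinear.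
have dd : d * (d + 1) != 0 by rewrite mulf_neq0// gt_eqF.
exists (`|2 / (d * (d + 1))|); first by rewrite normr_gt0 mulf_neq0// invr_eq0.
move=> [|k]; first by rewrite power_kernelE// !(mul0r, mulr0) normr0.
have k1 : 1 <= k.+1%:R :> R by rewrite ler1n.
rewrite power_kernelE// normrM -mulrA ler_wpM2l// normrM normr_nat ler_wpM2l//.
apply: (@le_trans _ _ (Num.max 1 (k.+1%:R `^ d))).
  have p0 := powR_ge0 (k.+1%:R : R) d.
  rewrite ler_norml le_max; apply/andP; split; last first.
    by apply/orP; right; lra.
  rewrite lerNl; apply: (@le_trans _ _ 1); first by lra.
  by rewrite le_max lexx.
rewrite ge_max; apply/andP; split.
  by rewrite (le_trans k1)// le1r_powR// le_max lexx.
by apply: ler_powR => //; rewrite le_max lexx orbT.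
Qed.

Lemma power_kernel_tame : tame power_kernel.
Proof.
have [B B0 hB] := power_kernel_growth.
have ds0 : 0 <= Num.max 1 d by rewrite le_max ler01.
have t : tame (fun k => B * k%:R * (2 `^ Num.max 1 d) ^+ k).
  by apply: tame_mul; [apply: tame_scale; exact: tame_id|exact: tame_exp].
apply: (tame_le t) => k; apply: le_trans (hB k) _.
apply: le_trans (ler_norm _); rewrite ler_wpM2l ?mulr_ge0 ?(ltW B0)//.
rewrite -powR_mulrn ?powR_ge0// powRAC; apply: ge0_ler_powR => //; rewrite ?nnegrE ?powR_ge0//.
by rewrite powR_mulrn// -natrX ler_nat ltnW// ltn_expl.
Qed.

Lemma power_kernel_collision : collision_kernel power_kernel.
Proof.
split.
- exact: power_kernel_tame.
- have [d0|d0] := eqVneq d 0; last by rewrite power_kernelE// mul0r mulr0.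
  by rewrite /power_kernel /power_div d0 eqxx mulr0 mul0r.
- have [d0|d0] := eqVneq d 0; last by rewrite power_kernelE// powR1 subrr !mulr0.
  by rewrite /power_kernel /power_div d0 eqxx divr1 ln1 mulr0.
- have l2 : 0 < ln (2 : R) by rewrite ln_gt0// ltr1n.
  have [dlt|dgt|d0] := ltgtP d 0.
  + rewrite power_kernelE ?lt_eqF// -mulrNN mulr_gt0//.
      by rewrite oppr_gt0 pmulr_rlt0// invr_lt0 nmulr_rlt0.
    rewrite -mulrN mulr_gt0// opprB subr_gt0 /powR pnatr_eq0/= expR_lt1.
    by rewrite nmulr_rlt0.
  + rewrite power_kernelE ?gt_eqF// mulr_gt0 ?divr_gt0 ?mulr_gt0// subr_gt0.
    by rewrite /powR pnatr_eq0/= expR_gt1 mulr_gt0.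
  + by rewrite /power_kernel /power_div d0 eqxx divr1 mulr_gt0// mulr_gt0.
- case=> [|k].
    have z k0 : (k0 <= 1)%N -> power_kernel k0 = 0.
      case: k0 => [|[|//]] _; have [d0|d0] := eqVneq d 0.
      + by rewrite /power_kernel /power_div d0 eqxx mulr0 mul0r.
      + by rewrite power_kernelE// mul0r mulr0.
      + by rewrite /power_kernel /power_div d0 eqxx divr1 ln1 mulr0.
      + by rewrite power_kernelE// powR1 subrr !mulr0.
    by rewrite !z.
  set x : R := k.+1%:R; have x1 : 1 <= x by rewrite ler1n.
  have x0 : 0 < x by exact: lt_le_trans x1.
  have yE : k.+2%:R = x + 1 by rewrite -natr1.
  have [dlt|dgt|d0] := ltgtP d 0.
  (* For d < 0: (x + 1)^(d + 1) - x^(d + 1) <= (x + 1)^d <= 1. *)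
  + have pd : x `^ d >= (x + 1) `^ d.
      rewrite /powR !gt_eqF ?addr_gt0// ler_expR ler_nM2l// ler_ln ?posrE ?addr_gt0//.
      by rewrite lerDl.
    have p1 : (x + 1) `^ d <= 1.
      rewrite /powR gt_eqF ?addr_gt0// expR_le1 nmulr_rle0// ln_ge0//; lra.
    rewrite !power_kernelE ?lt_eqF// yE -/x ler_wnM2l//.
      by rewrite ltW// pmulr_rlt0// invr_lt0 nmulr_rlt0.
    have := ler_wpM2l (ltW x0) pd; lra.
  + have pd : x `^ d <= (x + 1) `^ d.
      by rewrite ge0_ler_powR ?nnegrE ?addr_ge0 ?(ltW dgt) ?(ltW x0)// lerDl.
    have p1 : 1 <= x `^ d by rewrite -[leLHS](powRr0 x) ler_powR// ltW.
    rewrite !power_kernelE ?gt_eqF// yE -/x ler_wpM2l//.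
      by rewrite divr_ge0// mulr_ge0// ltW.
    by apply: ler_pM; rewrite ?(ltW x0) ?subr_ge0 ?lerB// lerDl.
  + rewrite /power_kernel /power_div d0 eqxx !divr1 yE -/x -!mulrA ler_wpM2l//.
    apply: ler_pM; rewrite ?ln_ge0 ?(ltW x0) ?lerDl//.
    by rewrite ler_ln ?posrE ?addr_gt0// lerDl.
Qed.

End PowerDivergence.

(** * Choice of the truncation level *)

Section TruncationLevel.
Context {R : realType}.

(** Raised to the power 2 D + 1, the bound on e gives
    e (n l e^2)^D <= c l.  Moreover n l >= sqrt N, so that e is at most a negative
    power of N, which beats (ln N)^D.  Hence e K^D is small for
    K = n l e^2 + ln N + O(1). *)
Lemma exists_truncation_level (D : R) : 1 <= D -> forall ka, 0 < ka -> exists2 c, 0 < c &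
  forall (n N : nat) (l e : R), l = n%:R / N%:R -> l <= 1 -> 1 <= n%:R * l ^+ 3 ->
  c^-1 <= n%:R -> 0 < e -> e <= c ->
  e <= c * (n%:R `^ D * l `^ (D - 1)) `^ (- (2 * D + 1)^-1) ->
  exists2 K : nat, n%:R * l * e ^+ 2 + ln N%:R <= K%:R & e * K%:R `^ D <= ka.
Proof.
move=> D1 ka ka0; have D0 : 0 < D by exact: lt_le_trans D1.
(* Chosen so that e <= N^(- 2 q D): one half of the exponent absorbs
   (ln N)^D <= (N^q / q)^D and the other half tends to 0. *)
pose q := (4 * (2 * D + 1))^-1.
have q0 : 0 < q by rewrite invr_gt0 mulr_gt0// addr_gt0// mulr_gt0.
pose k1 := ka / (3 * 3 `^ D).
have k10 : 0 < k1 by rewrite divr_gt0// mulr_gt0// powR_gt0.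
pose c := Num.min 1 (Num.min k1 ((k1 * q `^ D) `^ (q * D)^-1)).
have c0 : 0 < c by rewrite !lt_min ltr01 k10 powR_gt0// mulr_gt0// powR_gt0.
exists c => // n N l e lE l1 nl3 cn e0 ec er.
have [c1 [c2 c3]] : c <= 1 /\ c <= k1 /\ c <= (k1 * q `^ D) `^ (q * D)^-1.
  by rewrite /c !ge_min !lexx !orbT.
have n0 : 0 < n%:R :> R.
  by rewrite lt_neqAle eq_sym ler0n andbT; apply: contraTneq nl3 => ->; rewrite mul0r ler10.
have N0 : 0 < N%:R :> R.
  rewrite lt_neqAle eq_sym ler0n andbT; apply: contraTneq nl3 => N0.
  by rewrite lE N0 invr0 mulr0 expr0n mulr0 ler10.
have l0 : 0 < l by rewrite lE divr_gt0.
have nE : n%:R = N%:R * l by rewrite lE mulrC divfK// gt_eqF.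
have nN : n%:R <= N%:R :> R by rewrite nE ler_piMr// ltW.
set v := n%:R * l * e ^+ 2.
have v0 : 0 < v by rewrite /v !mulr_gt0// exprn_gt0.
set Y := n%:R `^ D * l `^ (D - 1) in er.
have Y0 : 0 < Y by rewrite mulr_gt0 ?powR_gt0.
have D20 : 0 < 2 * D + 1 by rewrite addr_gt0// mulr_gt0.
have rpow : (Y `^ (- (2 * D + 1)^-1)) `^ (2 * D + 1) = Y^-1.
  by rewrite -powRrM mulNr mulVf ?gt_eqF// powR_inv1// ltW.
have nlD : (n%:R * l) `^ D = Y * l.
  rewrite powRM ?(ltW n0) ?(ltW l0)// /Y -mulrA; congr (_ * _).
  by rewrite mulrC mulr_powRB1// ltW.
have h2 : e * v `^ D <= k1.
  have -> : e * v `^ D = (n%:R * l) `^ D * e `^ (2 * D + 1).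
    rewrite /v (powRM _ (mulr_ge0 (ltW n0) (ltW l0)) (sqr_ge0 e)).
    rewrite mulrCA; congr (_ * _); rewrite -(powR_mulrn 2 (ltW e0)) -powRrM.
    by rewrite [in RHS]powRD ?(gt_eqF e0) ?implybT// (powRr1 (ltW e0)) mulrC.
  apply: (@le_trans _ _ ((n%:R * l) `^ D * (c * Y^-1))).
    rewrite ler_wpM2l ?powR_ge0//.
    apply: (@le_trans _ _ ((c * Y `^ (- (2 * D + 1)^-1)) `^ (2 * D + 1))).
      by rewrite ge0_ler_powR ?nnegrE ?(ltW D20) ?(ltW e0)// mulr_ge0 ?powR_ge0 ?(ltW c0).
    rewrite powRM ?powR_ge0 ?(ltW c0)// rpow ler_wpM2r ?invr_ge0 ?(ltW Y0)//.
    by rewrite ge1r_powR ?c0// lerDr mulr_ge0// ltW.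
  rewrite nlD (_ : Y * l * (c * Y^-1) = l * c); last by field; rewrite gt_eqF.
  by apply: le_trans c2; rewrite ler_piMl// ltW.
have lnN0 : 0 <= ln (N%:R : R).
  by rewrite ln_ge0// ler1n -(ltr_nat R).
have h3 : e * (ln N%:R) `^ D <= k1.
  have NlN : N%:R `^ 2^-1 <= n%:R * l.
    rewrite -(@ler_pXn2r _ 2)// ?nnegrE ?powR_ge0 ?mulr_ge0 ?(ltW n0) ?(ltW l0)//.
    rewrite -powR_mulrn ?powR_ge0// -powRrM mulVf// powRr1 ?(ltW N0)//.
    rewrite (_ : (n%:R * l) ^+ 2 = N%:R * (n%:R * l ^+ 3)); last by rewrite nE; ring.
    by rewrite ler_peMr// ltW.
  have YN : (N%:R `^ 2^-1) `^ D <= Y.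
    apply: (@le_trans _ _ ((n%:R * l) `^ D)).
      by rewrite ge0_ler_powR ?nnegrE ?powR_ge0 ?(ltW D0)// mulr_ge0 ?(ltW n0) ?(ltW l0).
    by rewrite nlD ler_piMr// ltW.
  have eN : e <= (N%:R `^ (q * D)) ^- 2.
    apply: le_trans er _; apply: (@le_trans _ _ (Y `^ (- (2 * D + 1)^-1))).
      by rewrite ler_piMl ?powR_ge0.
    have Nq2 : 0 < (N%:R `^ (q * D)) ^+ 2 by apply: exprn_gt0; exact: powR_gt0.
    rewrite powRN (lef_pV2 (powR_gt0 _ Y0 : _ \is Num.pos) (Nq2 : _ \is Num.pos)).
    apply: (@le_trans _ _ (((N%:R `^ 2^-1) `^ D) `^ (2 * D + 1)^-1)); last first.
      by rewrite ge0_ler_powR ?nnegrE ?powR_ge0 ?invr_ge0 ?(ltW D20) ?(ltW Y0).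
    rewrite -!powRrM -powR_mulrn ?powR_ge0// -powRrM.
    rewrite (_ : q * D * 2%:R = 2^-1 * (D * (2 * D + 1)^-1))// /q.
    by field; rewrite !gt_eqF// addr_gt0// mulr_gt0// addr_gt0// mulr_gt0.
  have lnq : ln N%:R <= N%:R `^ q / q.
    rewrite ler_pdivlMr// mulrC -ln_powR ltW// ln_sublinear//.
    exact: powR_gt0.
  have lnqD : (ln N%:R) `^ D <= N%:R `^ (q * D) * (q `^ D)^-1.
    apply: (@le_trans _ _ ((N%:R `^ q / q) `^ D)).
      by rewrite ge0_ler_powR ?nnegrE ?(ltW D0)// divr_ge0 ?powR_ge0// ltW.
    have q1 : 0 <= q^-1 by rewrite invr_ge0 ltW.
    by rewrite (powRM D (powR_ge0 N%:R q) q1) -powRrM -[q^-1](powR_inv1 (ltW q0)) -powRrM mulN1r powRN.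
  have Nq0 : 0 < N%:R `^ (q * D) :> R by rewrite powR_gt0.
  have Nqc : (N%:R `^ (q * D))^-1 <= k1 * q `^ D.
    have qDn0 : q * D != 0 by rewrite mulf_neq0 ?gt_eqF.
    have qDp : 0 <= q * D := mulr_ge0 (ltW q0) (ltW D0).
    have kq0 : 0 <= k1 * q `^ D := mulr_ge0 (ltW k10) (powR_ge0 _ _).
    have Ni0 : 0 <= N%:R^-1 :> R by rewrite invr_ge0 ltW.
    have -> : (N%:R `^ (q * D))^-1 = (N%:R^-1) `^ (q * D).
      by rewrite -powRN -(powR_inv1 (ltW N0)) -powRrM mulN1r.
    have <- : ((k1 * q `^ D) `^ (q * D)^-1) `^ (q * D) = k1 * q `^ D.
      by rewrite -powRrM mulVf// powRr1.
    rewrite ge0_ler_powR ?nnegrE ?powR_ge0//; apply: le_trans c3.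
    by rewrite -[leRHS]invrK lef_pV2 ?posrE ?invr_gt0//; exact: le_trans cn nN.
  apply: (@le_trans _ _ ((N%:R `^ (q * D)) ^- 2 * (N%:R `^ (q * D) * (q `^ D)^-1))).
    by rewrite ler_pM ?powR_ge0// ltW.
  have qD0 : 0 < q `^ D by rewrite powR_gt0.
  rewrite (_ : _ * _ = (N%:R `^ (q * D))^-1 / q `^ D); last first.
    by field; rewrite !gt_eqF.
  by rewrite ler_pdivrMr.
exists (Num.truncn (v + ln N%:R)).+1.
  have /andP[_ /ltW] := truncn_itv (addr_ge0 (ltW v0) lnN0).
  by [].
set K := _.+1.
have KX : K%:R <= v + ln N%:R + 1.
  have /andP[h _] := truncn_itv (addr_ge0 (ltW v0) lnN0).
  by rewrite /K -natr1 lerD2r.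
pose M := Num.max v (Num.max (ln N%:R) 1).
have vM : v <= M by rewrite /M le_max lexx.
have lM : ln N%:R <= M by rewrite /M !le_max lexx orbT.
have oM : 1 <= M by rewrite /M !le_max lexx !orbT.
have KM : K%:R <= 3 * M by move: KX vM lM oM; clear; lra.
have eM : e * M `^ D <= k1.
  rewrite /M; case: (leP v) => _; last by [].
  by case: (leP (ln _)) => _ //; rewrite powR1 mulr1; exact: le_trans c2.
apply: (@le_trans _ _ (e * (3 * M) `^ D)).
  rewrite ler_wpM2l ?(ltW e0)// ge0_ler_powR ?nnegrE ?(ltW D0)// mulr_ge0//.
  exact: le_trans oM.
rewrite powRM//; last exact: le_trans oM.
have p3 : 0 < 3 `^ D :> R by rewrite powR_gt0.
rewrite mulrCA; apply: (@le_trans _ _ (3 `^ D * k1)); first by rewrite ler_wpM2l// ltW.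
have -> : 3 `^ D * k1 = ka / 3.
  by rewrite /k1 invfM mulrCA (mulrCA _ 3^-1) mulfV ?gt_eqF// mulr1.
by rewrite ler_pdivrMr// ler_peMr ?(ltW ka0)// ler1n.
Qed.

End TruncationLevel.

(** * Limit of the slope *)

Section SlopeLimit.
Context {R : realType}.
Context (f : nat -> R).
Context (fP : collision_kernel f).

(** The constant factors of the two bounds disappear after division by
    n lam e^2, which is large. *)
Lemma slope_near_quarter z : 0 < z -> exists2 c, 0 < c &
  forall N n (eps : 'I_N -> R) (lam e : R) K,
  (0 < N)%N -> (0 < n)%N -> lam = n%:R / N%:R -> lam <= c ->
  (forall m, `|eps m| <= 2^-1) -> \sum_m eps m = 0 ->
  N%:R * e = \sum_m eps m ^+ 2 -> 0 < e -> e <= c ->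
  c^-1 <= n%:R * lam * e ^+ 2 ->
  (forall k, (k <= K)%N -> e * f k <= f 2%N * k%:R) ->
  n%:R * lam * e ^+ 2 + ln N%:R <= K%:R ->
  `|- ln (multinomial_prob n (fun _ : 'I_N => N%:R^-1)
     (exceeds f (\sum_m poisson_E (lam * (1 + eps m)) f))) / (n%:R * lam * e ^+ 2) - 4^-1| <= z.
Proof.
move=> z0.
have [C C0 hU] := upper_bound fP.
have [B B1 hL] := lower_bound fP.
have B0 : 0 < B by exact: lt_le_trans B1.
pose dl := Num.min B^-1 (z / (2 * B)).
have dl0 : 0 < dl by rewrite lt_min invr_gt0 B0 divr_gt0// mulr_gt0.
have dlB : dl <= B^-1 by rewrite ge_min lexx.
have Bdl : B * dl <= z / 2.
  have : dl <= z / (2 * B) by rewrite ge_min lexx orbT.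
  by rewrite ler_pdivlMr ?mulr_gt0//; move: z0; clear -fP; lra.
have [c1 c10 hc1] := hL dl dl0 dlB.
have l8 : 0 < ln (8 : R) by rewrite ln_gt0// ltr1n.
have l2 : 0 < ln (2 : R) by rewrite ln_gt0// ltr1n.
pose c := Num.min 1 (Num.min c1 (Num.min (expR (-1)) (Num.min (z / (4 * (C + 1)))
   (Num.min (z / (2 * ln 8)) (z / (2 * ln 2)))))).
have c0 : 0 < c.
  by rewrite !lt_min ltr01 c10 expR_gt0 !divr_gt0 ?mulr_gt0// ltr_wpDl.
exists c => // N n eps lam e K N0 n0 lamE lamc heps s0 he e0 ec hv hK hvK.
have [d1 [d2 [d3 [d4 [d5 d6]]]]] : c <= 1 /\ c <= c1 /\ c <= expR (-1) /\
   c <= z / (4 * (C + 1)) /\ c <= z / (2 * ln 8) /\ c <= z / (2 * ln 2).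
  by rewrite /c !ge_min !lexx !orbT.
have hv1 : c1^-1 <= n%:R * lam * e ^+ 2 by apply: le_trans hv; rewrite lef_pV2 ?posrE.
have lo := hc1 N n eps lam e N0 n0 lamE (le_trans lamc d2) heps s0 he e0 (le_trans ec d2)
  hv1.
have up := hU N n eps lam e K N0 n0 lamE (le_trans lamc d3) heps s0 he e0 (le_trans ec d1) hK hvK.
set P := multinomial_prob _ _ _ in lo up *.
set v := n%:R * lam * e ^+ 2 in lo up hv *.
have l0 : 0 < lam by rewrite lamE divr_gt0 ?ltr0n.
have v0 : 0 < v by rewrite /v mulr_gt0 ?mulr_gt0 ?ltr0n// exprn_gt0.
have P0 : 0 < P by apply: lt_le_trans lo; rewrite mulr_gt0 ?expR_gt0.
have cv a : 0 < a -> c <= z / (2 * a) -> a <= v * (z / 2).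
  move=> a0 ca; rewrite mulrC -ler_pdivrMl ?divr_gt0//; apply: le_trans hv.
  rewrite (_ : _ * a = (z / (2 * a))^-1); last by field; rewrite !gt_eqF.
  by rewrite lef_pV2 ?posrE ?divr_gt0 ?mulr_gt0.
have lnlo : - ln P <= ln 2 + v * (4^-1 + B * dl).
  have : ln (2^-1 * expR (- (v * (4^-1 + B * dl)))) <= ln P.
    by rewrite ler_ln ?posrE// mulr_gt0 ?expR_gt0.
  by rewrite lnM ?posrE ?expR_gt0// lnV ?posrE// expRK; clear -fP; lra.
have lnup : v * (4^-1 - C * (lam + e)) - ln 8 <= - ln P.
  have : ln P <= ln (8 * expR (- (v * (4^-1 - C * (lam + e))))).
    by rewrite ler_ln ?posrE// mulr_gt0 ?expR_gt0.
  by rewrite lnM ?posrE ?expR_gt0// expRK; clear -fP; lra.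
have hC : C * (lam + e) <= z / 2.
  apply: (@le_trans _ _ (C * (2 * c))); first by rewrite ler_wpM2l//; move: lamc ec; clear -fP; lra.
  have : c * (4 * (C + 1)) <= z by rewrite -ler_pdivlMr// mulr_gt0// ltr_wpDl.
  by move: c0; clear -fP; lra.
have -> : - ln P / v - 4^-1 = (- ln P - v / 4) / v by field; rewrite gt_eqF.
rewrite normrM normfV (gtr0_norm v0) ler_pdivrMr// ler_norml.
have h8 := cv _ l8 d5; have h2 := cv _ l2 d6.
have k1 := ler_wpM2l (ltW v0) hC; have k2 := ler_wpM2l (ltW v0) Bdl.
apply/andP; split.
  by move: lnup h8 k1; clear -fP; lra.
by move: lnlo h2 k2; clear -fP; lra.
Qed.

End SlopeLimit.

Section SlopeEvent.
Context {R : realType}.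

Lemma multinomial_prob_ext n N (p : 'I_N -> R) (A B : pred ('I_N -> nat)) :
  (forall k : 'I_N -> nat, (\sum_m k m)%N = n -> A k = B k) ->
  multinomial_prob n p A = multinomial_prob n p B.
Proof.
move=> AB; rewrite /multinomial_prob big_mkcond [RHS]big_mkcond; apply: eq_bigr => k _.
have [kn|kn] := eqVneq (\sum_m k m)%N n; first by rewrite AB.
by rewrite /multinomial_pmf (negbTE kn); do 2 case: ifP.
Qed.

(** Statistic and threshold are the same increasing affine image of their
    counterparts for the fixed kernel: the counts and the Poisson means both add
    up to n. *)
Lemma alpha_slope_kernel (N : nat -> nat) (eps : forall n : nat, 'I_(N n) -> R) d n :
  -1 < d -> (0 < N n)%N -> (0 < n)%N ->
  (forall m : 'I_(N n), 0 < cell_prob eps m) -> \sum_m eps n m = 0 ->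
  alpha_slope eps (power_div d (lam N n)) n =
  - ln (multinomial_prob n (fun _ : 'I_(N n) => (N n)%:R^-1)
     (exceeds (power_kernel d) (\sum_m poisson_E (lam N n * (1 + eps n m)) (power_kernel d)))).
Proof.
move=> d1 N0 n0 p0 s0.
have NR : 0 < (N n)%:R :> R by rewrite ltr0n.
have l0 : 0 < lam N n :> R by rewrite divr_gt0 ?ltr0n.
have [be hbe] := power_div_affine d l0.
set al := _ `^ _ in hbe; have al0 : 0 < al by rewrite powR_gt0// invr_gt0.
rewrite /alpha_slope /prob_H0; congr (- ln _); apply: multinomial_prob_ext => k kn.
have tf := power_kernel_tame d1.
have muE m : n%:R * cell_prob eps m = lam N n * (1 + eps n m).
  by rewrite /cell_prob /lam mulrA.
have mu0 m : 0 < lam N n * (1 + eps n m) by rewrite -muE mulr_gt0 ?ltr0n.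
have -> : (N n)%:R * A1 eps (power_div d (lam N n)) n
   = al * (\sum_m poisson_E (lam N n * (1 + eps n m)) (power_kernel d)) + be * n%:R.
  rewrite /A1 mulVKf ?gt_eqF//.
  transitivity (\sum_(m < N n) (al * poisson_E (lam N n * (1 + eps n m)) (power_kernel d)
      + be * (lam N n * (1 + eps n m)))).
    apply: eq_bigr => m _; rewrite muE; have := mu0 m; set mu := _ * (1 + _) => mup.
    transitivity (al * poisson_E mu (power_kernel d) + be * poisson_E mu (fun k => k%:R)).
      rewrite -poisson_E_lin//; last exact: tame_id.
      by congr poisson_E; apply: funext => j; rewrite hbe.
    by rewrite poisson_E_id.
  rewrite big_split/= -!mulr_sumr big_split/= s0 addr0 sumr_const card_ord.
  by rewrite /lam divfK ?gt_eqF.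
have -> : stat (power_div d (lam N n)) k = al * (\sum_m power_kernel d (k m)) + be * n%:R.
  have -> : n%:R = \sum_m (k m)%:R :> R by rewrite -natr_sum kn.
  rewrite /stat !mulr_sumr -big_split/=.
  by apply: eq_bigr => m _; rewrite hbe.
by rewrite ltrD2r ltr_pM2l.
Qed.

End SlopeEvent.

Theorem theorem3p2 (R : realType) (N : nat -> nat)
    (eps : forall n : nat, 'I_(N n) -> R) (d : R)
    (e := eps_bar eps) (l := fun n : nat => lam N n : R)
    (ds := Num.max 1 d)
    (rate1 := fun n : nat =>
       (n%:R `^ ds * l n `^ (ds - 1)) `^ (- (2 * ds + 1)^-1) : R)
    (rate2 := fun n : nat => (n%:R * l n `^ (4 / 3)) `^ (- (3 / 8)) : R)
    (hd : -1 < d)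
    (hscheme : @multinomial_scheme R N)
    (hlam : l @ \oo --> (0 : R))
    (hnlam : (fun n => n%:R * l n ^+ 3) @ \oo --> +oo)
    (halt : intermediate_alternatives eps)
    (hcase :
       ((d <= 0 \/ (1 <= d /\ d \is a Num.int)) /\ e =o_\oo rate1)
       \/
       ((0 < d /\ d \isn't a Num.int) /\
         e =o_\oo (fun n => Num.min (rate2 n) (rate1 n)))) :
  exists r : nat -> R, r @ \oo --> (0 : R) /\
    \forall n \near \oo,
      alpha_slope eps (power_div d (l n)) n / (n%:R * l n * e n ^+ 2)
      = 4^-1 * rho (l n) (power_div d (l n)) ^+ 2 * (1 + r n).
Proof.
have fP := power_kernel_collision hd; set f := power_kernel d in fP.
have ds1 : 1 <= ds by rewrite le_max lexx.
have f2 : 0 < f 2%N := ck2 fP.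
have [[hpos hsum _ hmax] hv _] := halt.
have rate1_ge0 n : 0 <= rate1 n by exact: powR_ge0.
(* In both cases the hypothesis bounds e by rate1. *)
have he1 c : 0 < c -> \forall n \near \oo, e n <= c * rate1 n.
  move=> c0.
  have h (g : nat -> R) : e =o_\oo g -> (forall n, `|g n| <= rate1 n) ->
      \forall n \near \oo, e n <= c * rate1 n.
    move=> /eqoP /(_ _ c0) + hg; apply: filterS => n hn.
    apply: le_trans (ler_norm _) _; apply: le_trans hn _.
    by rewrite ler_wpM2l// ltW.
  case: hcase => -[_ ho].
    by apply: (h _ ho) => n; rewrite ger0_norm.
  apply: (h _ ho) => n.
  have m0 : 0 <= Num.min (rate2 n) (rate1 n).
    by rewrite le_min; apply/andP; split; [exact: powR_ge0|exact: rate1_ge0].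
  by rewrite (ger0_norm m0) ge_min; apply/orP; right; exact: lexx.
have nl3 : \forall n \near \oo, 1 <= n%:R * l n ^+ 3.
  by move/cvgryPge : hnlam; exact.
have l_small c : 0 < c -> \forall n \near \oo, l n <= c.
  move=> c0; move/cvgrPdist_le : hlam => /(_ _ c0); apply: filterS => n.
  by rewrite sub0r normrN; exact: le_trans (ler_norm _).
have max_small c : 0 < c ->
    \forall n \near \oo, \big[Num.max/0]_(m < N n) `|eps n m| <= c.
  move=> c0; move/cvgrPdist_le : hmax => /(_ _ c0); apply: filterS => n.
  by rewrite sub0r normrN; exact: le_trans (ler_norm _).
have v_large A : \forall n \near \oo, A <= Num.sqrt (n%:R * l n) * e n.
  by move/cvgryPge : hv; exact.
have pos n : 1 <= n%:R * l n ^+ 3 -> [/\ (0 < n)%N, (0 < N n)%N & 0 < l n].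
  move=> h; have n0 : (0 < n)%N.
    by rewrite lt0n; apply: contraTneq h => ->; rewrite mul0r ler10.
  have N0 : (0 < N n)%N.
    rewrite lt0n; apply: contraTneq h => N0.
    by rewrite /l /lam N0 invr0 mulr0 expr0n mulr0 ler10.
  by split => //; rewrite divr_gt0 ?ltr0n.
have NeE n : (0 < N n)%N -> (N n)%:R * e n = \sum_m eps n m ^+ 2.
  move=> N0; have NR : (N n)%:R != 0 :> R by rewrite pnatr_eq0 -lt0n.
  rewrite /e /eps_bar mulVKf//; apply: eq_bigr => m _.
  by rewrite /cell_prob mulVKf// addrAC subrr add0r.
have slope_cvg : (fun n => alpha_slope eps (power_div d (l n)) n / (n%:R * l n * e n ^+ 2))
    @ \oo --> (4^-1 : R).
  apply/cvgrPdist_le => z z0.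
  have [c c0 hc] := slope_near_quarter fP z0.
  have [B B0 hB] := power_kernel_growth hd.
  have [c' c'0 hK] := exists_truncation_level ds1 (divr_gt0 f2 B0).
  have cc0 : 0 < Num.min 2^-1 (Num.min c c').
    by rewrite !lt_min invr_gt0 ltr0n c0.
  near=> n.
  have [n0 N0 ln0] : [/\ (0 < n)%N, (0 < N n)%N & 0 < l n] by apply: pos; near: n.
  have lc : l n <= Num.min 2^-1 (Num.min c c') by near: n; exact: l_small.
  have mc : \big[Num.max/0]_(m < N n) `|eps n m| <= Num.min 2^-1 (Num.min c c').
    by near: n; exact: max_small.
  move: lc mc; rewrite !le_min => /and3P[lc1 lc2 lc3] /and3P[mc1 mc2 mc3].
  set M := \big[_/_]_(m < N n) _ in mc1 mc2 mc3.
  have epsM m : `|eps n m| <= M by exact: (le_bigmax 0 (fun m => `|eps n m|) m).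
  have NR : 0 < (N n)%:R :> R by rewrite ltr0n.
  have M0 : 0 <= M by exact: (le_trans (normr_ge0 _) (epsM (Ordinal N0))).
  have eM : e n <= M.
    rewrite -(ler_pM2l NR) NeE//.
    apply: (@le_trans _ _ (\sum_(m < N n) M)); last first.
      by rewrite sumr_const card_ord mulr_natl.
    apply: ler_sum => m _; rewrite -real_normK ?num_real// expr2 -[leRHS]mulr1.
    by rewrite ler_pM// (le_trans (epsM m))// (le_trans mc1)// invf_le1// ler1n.
  have vl : Num.max 1 c^-1 <= Num.sqrt (n%:R * l n) * e n by near: n; exact: v_large.
  move: vl; rewrite ge_max => /andP[v1 vc].
  have e0 : 0 < e n.
    rewrite ltNge; apply/negP => e0; move: v1; apply/negP; rewrite -ltNge.
    by apply: le_lt_trans ltr01; rewrite mulr_ge0_le0 ?sqrtr_ge0.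
  have nl0 : 0 <= n%:R * l n by rewrite mulr_ge0// ltW.
  have vv : c^-1 <= n%:R * l n * e n ^+ 2.
    rewrite -(sqr_sqrtr nl0) -exprMn; apply: le_trans vc _.
    by rewrite expr2 ler_peMl// (le_trans ler01).
  have nc : c'^-1 <= n%:R by near: n; exact: nbhs_infty_ger.
  have nl3n : 1 <= n%:R * l n ^+ 3 by near: n.
  have er : e n <= c' * rate1 n by near: n; exact: he1.
  have h21 : 2^-1 <= 1 :> R by rewrite invf_le1// ler1n.
  have [K hKv hKe] := hK n (N n) (l n) (e n) erefl (le_trans lc1 h21) nl3n nc e0
    (le_trans eM mc3) er.
  rewrite distrC alpha_slope_kernel//; [|exact: hpos|exact: hsum].
  apply: (hc (N n) n (eps n) (l n) (e n) K) => //.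
  - by move=> m; exact: le_trans (epsM m) mc1.
  - exact: hsum.
  - exact: NeE.
  - exact: le_trans eM mc2.
  move=> k kK; apply: le_trans (ler_wpM2l (ltW e0) (ler_norm _)) _.
  apply: le_trans (ler_wpM2l (ltW e0) (hB k)) _.
  have kKp : k%:R `^ ds <= K%:R `^ ds.
    by rewrite ge0_ler_powR ?nnegrE ?ler_nat// (le_trans ler01).
  apply: (@le_trans _ _ (B * k%:R * (e n * K%:R `^ ds))).
    by rewrite mulrCA ler_wpM2l ?mulr_ge0 ?(ltW B0)// ler_wpM2l// ltW.
  apply: le_trans (ler_wpM2l _ hKe) _; first by rewrite mulr_ge0// ltW.
  by rewrite mulrAC mulrCA mulfV ?gt_eqF// mulr1.
have rho_cvg : (fun n => rho (l n) (power_div d (l n)) ^+ 2) @ \oo --> (1 : R).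
  apply/cvgrPdist_le => z z0; have [c c0 hc] := rho_sqr_near1 fP z0.
  near=> n.
  have [n0 N0 ln0] : [/\ (0 < n)%N, (0 < N n)%N & 0 < l n] by apply: pos; near: n.
  have lc : l n <= c by near: n; exact: l_small.
  have [be hbe] := power_div_affine d ln0.
  rewrite distrC (_ : power_div d (l n) = fun k => (l n)^-1 `^ d * f k + be * k%:R).
    by apply: hc => //; rewrite gt_eqF// powR_gt0// invr_gt0.
  by apply/funext => k; rewrite hbe.
pose r n := 4 * (alpha_slope eps (power_div d (l n)) n / (n%:R * l n * e n ^+ 2))
   * (rho (l n) (power_div d (l n)) ^+ 2)^-1 - 1.
exists r; split.
  rewrite -[X in _ --> X](_ : 4 * 4^-1 * 1^-1 - 1 = 0 :> R); last first.
    by rewrite invr1 mulr1 mulfV ?subrr.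
  apply: cvgB; last exact: cvg_cst.
  by apply: cvgM; [exact: cvgMr|exact: cvgV rho_cvg].
near=> n.
have r0 : rho (l n) (power_div d (l n)) ^+ 2 != 0.
  suff : 0 < rho (l n) (power_div d (l n)) ^+ 2 by move=> /gt_eqF ->.
  near: n; exact: (cvgr_gt _ rho_cvg).
by rewrite /r; move: r0; set x := _ / _; set y := _ ^+ 2 => y0; field.
Unshelve. all: by end_near.
Qed.
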